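(* Let $X$ be a non-empty set and let $S,B\subseteq\{-1,1,*\}^X$ be (partial) binary hypothesis classes. For any $\varepsilon,\delta\in(0,1/4)$, \[ \#\mathsf{CompL}(S,B,\varepsilon,\delta)=O\!\left(\frac{\mathsf{VC}(S,B)}{\varepsilon^2}\log_+^2\!\left(\frac{\mathsf{VC}(S,B)}{\varepsilon}\right)+\frac{1}{\varepsilon^2}\log\!\left(\frac1\delta\right)\right). \] Moreover, when $\mathsf{VC}(S,B)\ge 2$, \[ \#\mathsf{CompL}(S,B,\varepsilon,\delta)=\Omega\!\left(\frac{\mathsf{VC}(S,B)}{\varepsilon}+\frac1\varepsilon\log\!\left(\frac1\delta\right)\right). \]
   Context: A (partial binary) hypothesis is a function $h:X\to\{-1,1,*\}$, where $*$ is an ''undefined'' label. All probability distributions are discrete (countable support). A subset $X'\subseteq X$ is shattered by a class $H$ if for every $\xi:X'\to\{-1,1\}$ there is $h\in H$ with $h(x)=\xi(x)$ for all $x\in X'$. The mutual VC dimension $\mathsf{VC}(S,B)$ is the supremum of $|X'|$ over subsets $X'\subseteq X$ shattered by both $S$ and $B$. Comparative learning: a (possibly randomized, computationally unbounded) learner takes $n$ data points in $X\times\{-1,1\}$ and outputs a model $f:X\to\{-1,1\}$. It solves $\mathsf{CompL}_n(S,B,\varepsilon,\delta)$ if for every distribution $\mu$ on $X\times\{-1,1\}$ such that $\Pr_{(x,y)\sim\mu}[s(x)=y]=1$ for some $s\in S$, when given $n$ i.i.d. samples from $\mu$, with probability at least $1-\delta$ (over samples and internal randomness) the output satisfies $\Pr_{(x,y)\sim\mu}[f(x)\ne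 y]\le\inf_{b\in B}\Pr_{(x,y)\sim\mu}[b(x)\ne y]+\varepsilon$ (note $b(x)=*$ counts as $b(x)\neq y$). $\#\mathsf{CompL}(S,B,\varepsilon,\delta)$ is the smallest $n\in\mathbb{Z}_{\ge0}$ for which such a learner exists. $\log$ is base 2 and $\log_+(u)=\log(\max\{2,u\})$; $O,\Omega$ hide absolute constants. *)

(* Defs.v *)
From HB Require Import structures.
From mathcomp Require Import all_boot all_order all_algebra.
From mathcomp Require Import all_classical all_reals.
From mathcomp Require Import ereal esum exp Rstruct.
From Stdlib Require Import Rdefinitions.
Set Implicit Arguments.
Unset Strict Implicit.
Unset Printing Implicit Defensive.
Import Order.TTheory GRing.Theory Num.Theory.
Local Open Scope classical_set_scope.
Local Open Scope ring_scope.
Local Open Scope ereal_scope.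

(* Labels {-1,1} are encoded by bool (true = 1, false = -1);
   partial labels {-1,1,star} by option bool (None = star). *)

(* A discrete probability distribution (probability mass function) on T:
   nonnegative weights summing (as an unordered sum) to 1.  A finite
   unordered sum forces countable support. *)
Definition is_pmf (T : choiceType) (p : T -> R) : Prop :=
  (forall t, (0 <= p t)%R) /\ \esum_(t in [set: T]) (p t)%:E = 1.

Definition Prob (T : choiceType) (p : T -> R) (E : set T) : \bar R :=
  \esum_(t in E) (p t)%:E.

Section Defs.
Variable X : Type.

Definition Pt := ({classic X} * bool)%type.

Definition phyp := X -> option bool.
Definition model := X -> bool.

Definition err_model (mu : Pt -> R) (f : model) : \bar R :=
  Prob mu [set z : Pt | f z.1 <> z.2].

(* b(x) = * counts as an error *)
Definition err_hyp (mu : Pt -> R) (b : phyp) : \bar R :=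
  Prob mu [set z : Pt | b z.1 <> Some z.2].

Definition realizable (S : set phyp) (mu : Pt -> R) : Prop :=
  exists2 s, S s & Prob mu [set z : Pt | s z.1 = Some z.2] = 1.

Definition opt_err (B : set phyp) (mu : Pt -> R) : \bar R :=
  ereal_inf [set err_hyp mu b | b in B].

(* A randomized learner using n samples: for each sample sequence it
   outputs a (discrete) distribution over models X -> {-1,1}. *)
Definition learner (n : nat) := ('I_n -> Pt) -> model -> R.

Definition valid_learner n (L : learner n) : Prop :=
  forall s, is_pmf (L s).

Local Close Scope ereal_scope.
Definition sample_prob (mu : Pt -> R) n (s : 'I_n -> Pt) : R :=
  \prod_(i < n) mu (s i).
Local Open Scope ereal_scope.

Definition success_prob (B : set phyp) (eps : R) n (L : learner n)
    (mu : Pt -> R) : \bar R :=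
  \esum_(s in [set: 'I_n -> Pt])
     (sample_prob mu s)%:E *
     Prob (L s) [set f : model | err_model mu f <= opt_err B mu + eps%:E].

Definition CompL (n : nat) (S B : set phyp) (eps delta : R) : Prop :=
  exists L : learner n, valid_learner L /\
    forall mu : Pt -> R, is_pmf mu -> realizable S mu ->
      (1 - delta)%:E <= success_prob B eps L mu.

(* #CompL: the least n for which a learner exists (+oo if none). *)
Definition numCompL (S B : set phyp) (eps delta : R) : \bar R :=
  ereal_inf [set (n%:R)%:E | n in [set n | CompL n S B eps delta]].

Definition shattered (H : set phyp) (A : set X) : Prop :=
  forall xi : X -> bool, exists2 h, H h & forall x, A x -> h x = Some (xi x).

(* Mutual VC dimension: supremum of |X'| over (finite) X' shattered by both.
   (Subsets of shattered sets are shattered, so restricting to finite X'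
   does not change the supremum; it is +oo iff arbitrarily large sets are
   shattered.) *)
Definition mutualVC (S B : set phyp) : \bar R :=
  ereal_sup [set ((size l)%:R)%:E | l in
     [set l : seq {classic X} | uniq l /\
        shattered S [set x | x \in l] /\ shattered B [set x | x \in l]]].

End Defs.

Definition log2 (u : R) : R := (ln u / ln 2)%R.
Definition logp (u : R) : R := log2 (Num.max 2%R u).

(* Main.v *)
(** Upper bound.  Let [agree s b] be the partial hypothesis defined where [s] and [b]
   agree: the class of these has VC dimension VC(S,B), and learning [b] over a
   distribution realized by [s] is agnostic learning of [agree s b].  On N = 32 d points
   drawn from the sample, one of them replaced by the test point, the halving algorithm
   (run with the number of shattered index sets as potential) makes at most N/4 mistakes
   along any hypothesis of the class; by averaging, for each weighting of the sample
   points on which a fixed hypothesis is right, some choice of N sample points gives a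
   predictor of weighted error at most 1/4.  Boosting O(log m) of them gives a predictor,
   encoded by O(d log m) sample indices, which is right wherever the hypothesis is right.
   The learner minimizes the empirical error among all such predictors; an exponential
   moment bound on the coordinates outside the code, and a union bound over codes, show
   that this generalizes.

   Lower bound.  Fix a distribution on a set shattered by S and B and pick the labelling
   uniformly at random: a point absent from the sample is mislabelled with probability
   1/2.  Mass 2 eps on one light point gives the term in log (1/delta), and mass 4 eps
   spread over d - 1 light points the term in d. *)
Require Import Defs.
From HB Require Import structures.
From mathcomp Require Import all_boot all_order all_algebra.
From mathcomp Require Import all_classical all_reals.
From mathcomp Require Import ereal sequences esum exp Rstruct.
From mathcomp Require Import ring lra zify.
Set Implicit Arguments.
Unset Strict Implicit.
Unset Printing Implicit Defensive.
Import Order.TTheory GRing.Theory Num.Theory.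
Local Open Scope classical_set_scope.
Local Open Scope ereal_scope.
Local Open Scope ring_scope.

Local Notation R := Rdefinitions.R.

(** * Expectations under discrete distributions and their powers *)

(** Finite partial sums give one inequality; the other is the same inequality for the factor 1/c and
    the family c * a. *)
Lemma esumZl (T : choiceType) (D : set T) (c : R) (a : T -> \bar R) :
  0 <= c -> (forall t, D t -> 0 <= a t)%E ->
  (\esum_(t in D) (c%:E * a t) = c%:E * \esum_(t in D) a t)%E.
Proof.
rewrite le_eqVlt => /predU1P[<-|c0] a0.
  by rewrite mul0e esum1// => t _; rewrite mul0e.
have le (b : R) (f : T -> \bar R) : 0 < b -> (forall t, D t -> 0 <= f t)%E ->
    (\esum_(t in D) (b%:E * f t) <= b%:E * \esum_(t in D) f t)%E.
  move=> b0 f0; apply: ge_ereal_sup => _ [A [finA AD] <-].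
  rewrite fsbig_finite//= big_seq -ge0_sume_distrr; last first.
    by move=> t; rewrite in_fset_set// inE => /AD/f0.
  rewrite lee_pmul2l// -big_seq -fsbig_finite//.
  by apply: ereal_sup_ubound; exists A.
apply/eqP; rewrite eq_le le//=.
have ca0 t : D t -> (0 <= c%:E * a t)%E by move=> /a0 ?; rewrite mule_ge0// lee_fin ltW.
have ci : 0 < c^-1 by rewrite invr_gt0.
have := le c^-1 _ ci ca0.
rewrite -(@lee_pmul2l _ c%:E)// ?lte_fin// muleA -EFinM divff ?gt_eqF// mul1e.
apply: le_trans; rewrite lee_pmul2l ?lte_fin//; apply: le_esum => t _.
by rewrite muleA -EFinM mulVf ?gt_eqF// mul1e.
Qed.

Definition expectation (T : choiceType) (p : T -> R) (phi : T -> \bar R) : \bar R :=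
  (\esum_(t in [set: T]) ((p t)%:E * phi t))%E.

(** The order inside [is_pmf] is that of the Stdlib reals; here it becomes the order of the ring
    structure. *)
Lemma is_pmfP (T : choiceType) (p : T -> R) :
  is_pmf p <-> (forall t, 0 <= p t) /\ (\esum_(t in [set: T]) (p t)%:E = 1)%E.
Proof. by split=> -[p0 p1]; split=> // t; apply/RleP; apply: p0. Qed.

Section Expectation.
Variables (T : choiceType) (p : T -> R).
Hypothesis pP : is_pmf p.

Let p0 t : 0 <= p t. Proof. by have [+ _] := proj1 (is_pmfP p) pP. Qed.

Lemma expectation_ge0 phi : (forall t, 0 <= phi t)%E -> (0 <= expectation p phi)%E.
Proof. by move=> phi0; apply: esum_ge0 => t _; rewrite mule_ge0// lee_fin. Qed.

Lemma eq_expectation phi psi :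
  phi =1 psi -> expectation p phi = expectation p psi.
Proof. by move=> e; apply: eq_esum => t _; rewrite e. Qed.

Lemma le_expectation phi psi :
  (forall t, phi t <= psi t)%E -> (expectation p phi <= expectation p psi)%E.
Proof. by move=> le; apply: le_esum => t _; rewrite lee_wpmul2l// lee_fin. Qed.

Lemma expectationZl c phi : 0 <= c -> (forall t, 0 <= phi t)%E ->
  (expectation p (fun t => c%:E * phi t) = c%:E * expectation p phi)%E.
Proof.
move=> c0 phi0; rewrite -esumZl//; last by move=> t _; rewrite mule_ge0// lee_fin.
by apply: eq_esum => t _; rewrite muleCA.
Qed.

Lemma expectationD phi psi : (forall t, 0 <= phi t)%E -> (forall t, 0 <= psi t)%E ->
  (expectation p (fun t => phi t + psi t) = expectation p phi + expectation p psi)%E.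
Proof.
move=> phi0 psi0; rewrite -esumD; last first.
- by move=> t _; rewrite mule_ge0// lee_fin.
- by move=> t _; rewrite mule_ge0// lee_fin.
by apply: eq_esum => t _; rewrite ge0_muleDr.
Qed.

Lemma expectation_sum (I : choiceType) (r : seq I) (P : pred I) (phi : I -> T -> \bar R) :
  (forall i t, 0 <= phi i t)%E ->
  (expectation p (fun t => \sum_(i <- r | P i) phi i t)
    = \sum_(i <- r | P i) expectation p (phi i))%E.
Proof.
move=> phi0; rewrite /expectation -esum_sum; last first.
  by move=> t i _ _; rewrite mule_ge0// lee_fin.
by apply: eq_esum => t _; rewrite ge0_sume_distrr.
Qed.

Lemma expectation_cst (c : R) : 0 <= c -> expectation p (fun=> c%:E) = c%:E.
Proof.
move=> c0; rewrite /expectation.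
under eq_esum do rewrite muleC.
rewrite esumZl//; last by move=> t _; rewrite lee_fin.
by have [_ ->] := pP; rewrite mule1.
Qed.

Lemma ProbE E : Prob p E = expectation p (fun t => (t \in E)%:R%:E).
Proof.
rewrite /Prob esum_mkcond; apply: eq_esum => t _.
by case: (t \in E); rewrite (mule1, mule0).
Qed.

Lemma Prob_ge0 E : (0 <= Prob p E)%E.
Proof. by rewrite ProbE expectation_ge0// => t; rewrite lee_fin. Qed.

Lemma le_Prob E F : E `<=` F -> (Prob p E <= Prob p F)%E.
Proof.
move=> EF; rewrite !ProbE; apply: le_expectation => t; rewrite lee_fin ler_nat.
by case: (boolP (t \in E)) => // /set_mem/EF/mem_set ->.
Qed.

Lemma Prob_le1 E : (Prob p E <= 1)%E.
Proof.
rewrite ProbE -(expectation_cst ler01); apply: le_expectation => t.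
by rewrite lee_fin lern1 leq_b1.
Qed.

Lemma Prob_fin E : Prob p E \is a fin_num.
Proof.
rewrite ge0_fin_numE ?Prob_ge0//; exact: le_lt_trans (Prob_le1 E) (ltry _).
Qed.

Lemma ProbC E : (Prob p E + Prob p (~` E) = 1)%E.
Proof.
rewrite !ProbE -expectationD; last 2 first.
- by move=> t; rewrite lee_fin.
- by move=> t; rewrite lee_fin.
rewrite -(expectation_cst ler01); apply: eq_expectation => t.
by rewrite in_setC -EFinD; case: (t \in E); rewrite (addr0, add0r).
Qed.

End Expectation.

(** * Product distributions and resampling of one coordinate *)

Definition upd (I : eqType) (T : Type) (z : I -> T) (i : I) (t : T) : I -> T :=
  fun j => if j == i then t else z j.

Lemma upd_same (I : eqType) (T : Type) (z : I -> T) i : upd z i (z i) = z.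
Proof. by apply/funext => j; rewrite /upd; case: eqP => [->|]. Qed.

Lemma upd_upd (I : eqType) (T : Type) (z : I -> T) i t u :
  upd (upd z i t) i u = upd z i u.
Proof. by apply/funext => j; rewrite /upd; case: eqP. Qed.

Section ProductMeasure.
Variables (T : choiceType) (mu : T -> R).
Hypothesis muP : is_pmf mu.

Let mu0 t : 0 <= mu t. Proof. by have [+ _] := proj1 (is_pmfP mu) muP. Qed.

Definition prodpmf n (z : 'I_n -> T) : R := \prod_(i < n) mu (z i).

Lemma prodpmf_ge0 n (z : 'I_n -> T) : 0 <= prodpmf z.
Proof. by apply: prodr_ge0 => i _. Qed.

Let scons n (u : T * ('I_n -> T)) : 'I_n.+1 -> T :=
  fun i => if unlift ord0 i is Some j then u.2 j else u.1.

Let scons_bij n : set_bij [set: T * ('I_n -> T)] setT (@scons n).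
Proof.
split=> //.
- move=> [t z] [t' z'] _ _ /= e; congr (_, _).
    by have := congr1 (@^~ ord0) e; rewrite /scons unlift_none.
  by apply/funext => j; have := congr1 (@^~ (lift ord0 j)) e; rewrite /scons liftK.
- move=> z _; exists (z ord0, z \o lift ord0) => //.
  by apply/funext => i; rewrite /scons; case: unliftP => [j ->|->].
Qed.

Lemma prodpmfP n : is_pmf (@prodpmf n).
Proof.
apply/is_pmfP; split=> [z|]; first exact: prodpmf_ge0.
elim: n => [|n IHn].
  rewrite (_ : setT = [set fun i : 'I_0 => False_rect T (notF (ltn_ord i))]).
    by rewrite esum_set1 /prodpmf ?big_ord0.
  by apply/seteqP; split=> // z _; apply/funext => -[].
rewrite (reindex_esum _ _ _ _ (scons_bij n)).
rewrite (_ : setT = [set: T] `*`` (fun=> [set: 'I_n -> T])); last first.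
  by apply/seteqP; split.
rewrite (eq_esum (b := fun u => (mu u.1)%:E * (prodpmf u.2)%:E)%E); last first.
  move=> [t z] _; rewrite /prodpmf big_ord_recl -EFinM; congr (_ * _)%:E.
    by rewrite /scons unlift_none.
  by apply: eq_bigr => i _; rewrite /scons liftK.
rewrite -(@esum_esum _ _ _ _ _ (fun t z => (mu t)%:E * (prodpmf z)%:E)%E); last first.
  by move=> t z _ _; rewrite -EFinM lee_fin mulr_ge0// prodpmf_ge0.
rewrite -[RHS](proj2 muP); apply: eq_esum => t _.
by rewrite esumZl// ?IHn ?mule1// => z _; rewrite lee_fin prodpmf_ge0.
Qed.

Let swap n (i : 'I_n) (u : ('I_n -> T) * T) := (upd u.1 i u.2, u.1 i).

Let swapK n (i : 'I_n) : involutive (swap i).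
Proof. by move=> [z t]; rewrite /swap /= upd_upd upd_same /upd eqxx. Qed.

(* The involution (z, t) |-> (z[i := t], z i) preserves the weight of (z, t). *)
Lemma resample n (i : 'I_n) (phi : ('I_n -> T) -> R) :
  (forall z, 0 <= phi z) ->
  expectation (@prodpmf n) (fun z => (phi z)%:E)
    = expectation (@prodpmf n)
        (fun z => expectation mu (fun t => (phi (upd z i t))%:E)).
Proof.
move=> phi0; rewrite [RHS]/expectation.
have setXT : [set: 'I_n -> T] `*`` (fun=> [set: T]) = setT by apply/seteqP; split.
rewrite (eq_esum (b := fun z => \esum_(t in [set: T])
    (prodpmf z * (mu t * phi (upd z i t)))%:E)); last first.
  move=> z _; rewrite -esumZl ?prodpmf_ge0// => t _.
  by rewrite lee_fin mulr_ge0.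
rewrite esum_esum; last by move=> z t _ _; rewrite lee_fin !mulr_ge0// prodpmf_ge0.
rewrite setXT (reindex_esum setT setT (swap i)); last first.
  split=> //; first by move=> u v _ _ /(can_inj (@swapK n i)).
  by move=> u _; exists (swap i u) => //; rewrite swapK.
rewrite (eq_esum (b := fun u => (prodpmf u.1 * (mu u.2 * phi u.1))%:E)); last first.
  move=> [z t] _ /=; rewrite upd_upd upd_same !mulrA; congr (_ * _)%:E; rewrite /=.
  rewrite /prodpmf (bigD1 i)//= [in RHS](bigD1 i)//= /upd eqxx.
  rewrite [RHS]mulrC mulrA [RHS]mulrAC; congr (_ * _ * _).
  by apply: eq_bigr => j /negPf ->.
rewrite -setXT -(@esum_esum _ _ _ _ _ (fun z t => (prodpmf z * (mu t * phi z))%:E)); last first.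
  by move=> z t _ _; rewrite lee_fin !mulr_ge0// prodpmf_ge0.
apply: eq_esum => z _.
under eq_esum do rewrite mulrA mulrAC EFinM.
rewrite esumZl ?mulr_ge0 ?prodpmf_ge0//; last by move=> t _; rewrite lee_fin.
by have [_ ->] := muP; rewrite mule1.
Qed.
End ProductMeasure.

(** * Exponential moments and deviations *)

(** exp y = 1 / exp (- y) <= 1 / (1 - y), and (1 + y + 2 y^2) (1 - y) >= 1 for y <= 1/2. *)
Lemma expR_le_quad (y : R) : y <= 1/2 -> expR y <= 1 + y + 2 * y ^+ 2.
Proof.
move=> y1; have h := expR_ge1Dx (- y).
have q0 : 0 < expR (- y) by exact: expR_gt0.
rewrite -[y in expR y]opprK expRN -div1r ler_pdivrMr//.
apply: (@le_trans _ _ ((1 + y + 2 * y ^+ 2) * (1 - y))).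
  have -> : (1 + y + 2 * y ^+ 2) * (1 - y) = 1 + y ^+ 2 * (1 - 2 * y) by ring.
  rewrite lerDl mulr_ge0 ?sqr_ge0//; lra.
apply: ler_wpM2l => //; have := sqr_ge0 (y + 1/4); rewrite !expr2; lra.
Qed.

Definition prob (T : choiceType) (p : T -> R) (E : set T) : R := fine (Prob p E).

Section Concentration.
Variables (T : choiceType) (mu : T -> R).
Hypothesis muP : is_pmf mu.

Lemma probK E : (prob mu E)%:E = Prob mu E.
Proof. by rewrite /prob fineK// Prob_fin. Qed.

Lemma prob_ge0 E : 0 <= prob mu E.
Proof. by rewrite -lee_fin probK Prob_ge0. Qed.

Lemma prob_le1 E : prob mu E <= 1.
Proof. by rewrite -lee_fin probK Prob_le1. Qed.

Lemma prob_setC E : prob mu (~` E) = 1 - prob mu E.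
Proof.
suff: prob mu E + prob mu (~` E) = 1 by lra.
by apply: EFin_inj; rewrite EFinD !probK ProbC.
Qed.

(** In the average of the two quadratic bounds the linear terms cancel, which leaves 1 + 2 l^2 p (1
    - p) <= 1 + l^2 / 2. *)
Lemma bernoulli_mgf (E : set T) (l : R) : `|l| <= 1/2 ->
  (expectation mu (fun t => (expR (l * (prob mu E - (t \in E)%:R)))%:E)
    <= (expR (l ^+ 2 / 2))%:E)%E.
Proof.
rewrite ler_norml => /andP[l1 l2]; set p := prob mu E.
have p0 : 0 <= p := prob_ge0 E; have p1 : p <= 1 := prob_le1 E.
rewrite (@eq_expectation _ _ _ (fun t =>
  (expR (l * p))%:E * (t \in ~` E)%:R%:E + (expR (l * (p - 1)))%:E * (t \in E)%:R%:E)%E);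
  last first.
  move=> t; rewrite in_setC; case: (t \in E) => /=.
    by rewrite mule0 add0e mule1.
  by rewrite mule0 adde0 mule1 subr0.
rewrite expectationD//.
rewrite !expectationZl ?expR_ge0//; try by move=> t; rewrite lee_fin.
rewrite -!ProbE -!probK prob_setC -!EFinM -EFinD lee_fin -/p.
have e1 : expR (l * p) <= 1 + l * p + 2 * (l * p) ^+ 2 by apply: expR_le_quad; nra.
have e2 : expR (l * (p - 1)) <= 1 + l * (p - 1) + 2 * (l * (p - 1)) ^+ 2.
  by apply: expR_le_quad; nra.
apply: (@le_trans _ _ (1 + l ^+ 2 / 2)); last exact: expR_ge1Dx.
have p1' : 0 <= 1 - p by lra.
apply: le_trans (lerD (ler_wpM2r p1' e1) (ler_wpM2r p0 e2)) _.
have -> : (1 + l * p + 2 * (l * p) ^+ 2) * (1 - p) +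
   (1 + l * (p - 1) + 2 * (l * (p - 1)) ^+ 2) * p
   = 1 + l ^+ 2 / 2 - l ^+ 2 / 2 * (2 * p - 1) ^+ 2 by field.
by rewrite gerBl mulr_ge0 ?sqr_ge0// divr_ge0 ?sqr_ge0.
Qed.

Variables (m : nat) (F : ('I_m -> T) -> set T) (J : {set 'I_m}).
Hypothesis F_J : forall z i t, i \notin J -> F (upd z i t) = F z.

Let dev l z i : R := expR (l * (prob mu (F z) - (z i \in F z)%:R)).

(** Indices outside [J] are resampled one at a time: [F z] does not see [z i], so averaging over
    [z i] touches only the factor of [i], to which [bernoulli_mgf] applies. *)
Let mgf (l : R) (s : seq 'I_m) : `|l| <= 1/2 -> uniq s -> {in s, forall i, i \notin J} ->
  (expectation (@prodpmf _ mu m) (fun z => (\prod_(i <- s) dev l z i)%:E)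
    <= (expR (l ^+ 2 / 2) ^+ size s)%:E)%E.
Proof.
move=> l1; elim: s => [_ _|i s IHs /= /andP[nis us] sJ].
  by rewrite expr0 -(expectation_cst (prodpmfP muP m) ler01);
     apply: le_expectation; [exact: prodpmfP | move=> z; rewrite big_nil].
have iJ : i \notin J by apply: sJ; rewrite inE eqxx.
rewrite (resample muP i); last by move=> z; apply: prodr_ge0 => j _; apply: expR_ge0.
rewrite exprS EFinM; apply: le_trans (lee_wpmul2l _ (IHs us _)); last 2 first.
- by rewrite lee_fin expR_ge0.
- by move=> j js; apply: sJ; rewrite inE js orbT.
have prod0 z : 0 <= \prod_(j <- s) dev l z j by apply: prodr_ge0 => j _; apply: expR_ge0.
rewrite -expectationZl ?expR_ge0//; last first.
  exact: prodpmfP.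
apply: le_expectation; first exact: prodpmfP.
move=> z; rewrite muleC.
rewrite (@eq_expectation _ _ _ (fun t => (\prod_(j <- s) dev l z j)%:E *
   (expR (l * (prob mu (F z) - (t \in F z)%:R)))%:E)%E); last first.
  move=> t; rewrite -EFinM big_cons mulrC {2}/dev F_J// {2}/upd eqxx.
  congr (_ * _)%:E; apply: eq_big_seq => j js; rewrite /dev F_J// /upd.
  by case: eqP => // ji; rewrite ji (negbTE nis) in js.
rewrite expectationZl//.
by apply: lee_wpmul2l; [rewrite lee_fin|exact: bernoulli_mgf].
Qed.

(** Exponential Markov inequality. [F] may depend on the sample through the coordinates in [J], as a
    predictor encoded by these does; the sign of [l] selects the tail. *)
Lemma deviation (l : R) : `|l| <= 1/2 ->
  prob (@prodpmf _ mu m)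
     [set z | l ^+ 2 * m%:R <=
       l * \sum_(i | i \notin J) (prob mu (F z) - (z i \in F z)%:R)]
    <= expR (- (l ^+ 2 / 2 * m%:R)).
Proof.
move=> l1; have PP := prodpmfP muP m; rewrite -lee_fin fineK ?Prob_fin//.
pose s := [seq i <- enum 'I_m | i \notin J].
have us : uniq s by rewrite filter_uniq// enum_uniq.
have sJ : {in s, forall i, i \notin J} by move=> i; rewrite mem_filter => /andP[].
apply: (@le_trans _ _ ((expR (- (l ^+ 2 * m%:R)))%:E *
   (expR (l ^+ 2 / 2) ^+ size s)%:E)%E); last first.
  have sm : (size s <= m)%N by rewrite -[X in (_ <= X)%N]card_ord cardE size_filter count_size.
  have c1 : 1 <= expR (l ^+ 2 / 2).
    by apply: le_trans (expR_ge1Dx _); rewrite lerDl divr_ge0 ?sqr_ge0.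
  rewrite -EFinM lee_fin; apply: (@le_trans _ _ (expR (- (l ^+ 2 * m%:R)) * expR (l ^+ 2 / 2) ^+ m)).
    by apply: ler_wpM2l; [exact: expR_ge0|exact: ler_weXn2l].
  rewrite -expRM_natr -exp.expRD le_eqVlt; apply/orP; left; apply/eqP; congr expR; lra.
apply: le_trans (lee_wpmul2l _ (mgf l1 us sJ)); last by rewrite lee_fin expR_ge0.
rewrite -expectationZl ?expR_ge0//; last first.
  by move=> z; rewrite lee_fin prodr_ge0// => j _; apply: expR_ge0.
rewrite ProbE; apply: le_expectation => // z; rewrite -EFinM lee_fin.
rewrite /dev -expR_sum -mulr_sumr /s big_filter big_enum_cond -exp.expRD.
rewrite -[X in X \in _]/z; case: (boolP (z \in _)) => [/set_mem /= zE|_]; last exact: expR_ge0.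
apply: le_trans (expR_ge1Dx _); rewrite lerDl; move: zE; rewrite addrC subr_ge0; exact.
Qed.

End Concentration.

(** * Shattered index sets and halving *)

Section Halving.
Variables (X : Type).
Implicit Types (V H : set (phyp X)) (x : X).

(** Index sets instead of point sets, so that they form a finite set whose cardinal serves as
    potential. On a shattered [I] the map [p] is injective. *)
Definition shat N (p : 'I_N -> X) V : {set {set 'I_N}} :=
  [set I : {set 'I_N} | `[< forall xi : 'I_N -> bool,
                 exists2 h, V h & forall i, i \in I -> h (p i) = Some (xi i) >]]%SET.

Lemma shatP N (p : 'I_N -> X) V (I : {set 'I_N}) :
  reflect (forall xi : 'I_N -> bool,
                 exists2 h, V h & forall i, i \in I -> h (p i) = Some (xi i))
    (I \in shat p V).
Proof. by rewrite inE; apply: asboolP. Qed.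

Definition restr V x b : set (phyp X) := [set h | V h /\ h x = Some b].

Lemma shat_restr_sub N (p : 'I_N -> X) V x b :
  shat p (restr V x b) \subset shat p V.
Proof.
apply/fintype.subsetP => I /shatP sI; apply/shatP => xi.
by have [h [Vh _] hI] := sI xi; exists h.
Qed.

Lemma shat_restr_notin N (p : 'I_N -> X) V t b I :
  I \in shat p (restr V (p t) b) -> t \notin I.
Proof.
move=> /shatP /(_ (fun=> ~~ b)) [h [_ hb] hI]; apply/negP => /hI.
by rewrite hb => -[]; case: (b).
Qed.

(* A set shattered by both halves stays shattered by V once t is added. *)
Lemma card_shat_restr N (p : 'I_N -> X) V t :
  (#|shat p (restr V (p t) true)| + #|shat p (restr V (p t) false)| <= #|shat p V|)%N.
Proof.
set A := shat p _; set B := shat p (restr V _ false).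
rewrite -cardsUI.
pose f (I : {set 'I_N}) := (t |: I)%SET.
have finj : {in (A :&: B)%SET &, injective f}.
  move=> I J /finset.setIP[/shat_restr_notin tI _] /finset.setIP[/shat_restr_notin tJ _] e.
  by rewrite -(finset.setU1K tI) -(finset.setU1K tJ) -/(f I) e.
rewrite -(card_in_imset finj) -cardsUI.
have -> : ((A :|: B) :&: [set f x | x in A :&: B])%SET = finset.set0.
  apply/eqP; rewrite -finset.subset0; apply/fintype.subsetP => I /finset.setIP[AB /imsetP[J _ e]].
  have : t \notin I by case/finset.setUP: AB => /shat_restr_notin.
  by rewrite e /f finset.setU11.
rewrite cards0 addn0 subset_leq_card// !finset.subUset !shat_restr_sub/=.
apply/fintype.subsetP => _ /imsetP[I /finset.setIP[/shatP IA /shatP IB] ->]; apply/shatP => xi.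
have [h [Vh ht] hI] : exists2 h, restr V (p t) (xi t) h &
    forall i, i \in I -> h (p i) = Some (xi i).
  by case: (xi t); [exact: IA|exact: IB].
by exists h => // i /finset.setU1P[->//|]; exact: hI.
Qed.

Definition version_space H N (p : 'I_N -> X) (y : 'I_N -> bool) (k : nat) :=
  [set h | H h /\ forall j : 'I_N, (j < k)%N -> h (p j) = Some (y j)].

(* Predicts at [x], which takes the place of [p t], after training on [p j], [j < t]; the
   points [p j] with [j > t] enter only through the potential, without their labels. *)
Definition halving H N (p : 'I_N -> X) (y : 'I_N -> bool) (t : 'I_N) x : bool :=
  let V := version_space H p y t in
  (#|shat (upd p t x) (restr V x false)| <= #|shat (upd p t x) (restr V x true)|)%N.

(** The [t]-th example is never consulted, so it can be exchanged with the test point in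
    [sum_miss_swap]. *)
Lemma halving_upd H N (p p' : 'I_N -> X) (y y' : 'I_N -> bool) t x :
  (forall j, j != t -> p j = p' j) -> (forall j, j != t -> y j = y' j) ->
  halving H p y t x = halving H p' y' t x.
Proof.
move=> pp yy; rewrite /halving.
have -> : upd p t x = upd p' t x.
  by apply/funext => j; rewrite /upd; case: eqVneq => // /pp.
suff -> : version_space H p y t = version_space H p' y' t by [].
apply/seteqP; split=> h [Hh hj]; split=> // j jt.
  by rewrite -pp ?neq_ltn ?jt// -yy ?neq_ltn ?jt//; apply: hj.
by rewrite pp ?neq_ltn ?jt// yy ?neq_ltn ?jt//; apply: hj.
Qed.

Definition mistakes H N (p : 'I_N -> X) (y : 'I_N -> bool) : nat :=
  \sum_(t < N) (halving H p y t (p t) != y t).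

(** By [card_shat_restr] the counts of the two halves add up to at most the count before. The
    prediction follows the larger half, so each mistake at least halves the count, which stays
    positive because [h] survives. *)
Lemma halving_mistakes H N (p : 'I_N -> X) (y : 'I_N -> bool) (h : phyp X) :
  H h -> (forall j, h (p j) = Some (y j)) ->
  (2 ^ mistakes H p y <= #|shat p H|)%N.
Proof.
move=> Hh hp; pose M k := (\sum_(t < N | t < k) (halving H p y t (p t) != y t))%N.
have step k : (k <= N)%N ->
    (2 ^ M k * #|shat p (version_space H p y k)| <= #|shat p H|)%N.
  elim: k => [_|k IHk kN].
    rewrite /M big_pred0// mul1n subset_leq_card//; apply/fintype.subsetP => I /shatP sI.
    by apply/shatP => xi; have [g [Hg _] gI] := sI xi; exists g.
  apply: leq_trans (IHk (ltnW kN)); pose t := Ordinal kN.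
  have MS : M k.+1 = ((halving H p y t (p t) != y t) + M k)%N.
    rewrite /M (bigD1 t)//=; congr (_ + _)%N; apply: eq_bigl => i.
    by rewrite ltnS [in RHS]ltn_neqAle andbC.
  rewrite MS expnD -mulnA mulnCA leq_pmul2l ?expn_gt0//.
  have -> : version_space H p y k.+1 = restr (version_space H p y k) (p t) (y t).
    apply/seteqP; split=> g.
      by move=> [Hg gj]; split; [split=> // j jk; apply: gj; rewrite ltnW|exact: gj].
    move=> [[Hg gj] gt]; split=> // j; rewrite ltnS leq_eqVlt => /predU1P[jk|]; last exact: gj.
    by have -> : j = t by exact: val_inj.
  have := card_shat_restr p (version_space H p y k) t.
  rewrite /halving upd_same -[(t : nat)]/k.
  set a := #|shat p (restr _ _ true)|; set b := #|shat p (restr _ _ false)|; set c := #|shat p _|.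
  case: (y t); rewrite -/a -/b; case: (leqP b a) => ab abc /=;
    rewrite ?expn0 ?expn1; lia.
have MN : M N = mistakes H p y by apply: eq_bigl => i; rewrite ltn_ord.
apply: leq_trans (step N (leqnn N)); rewrite MN leq_pmulr// card_gt0.
apply/finset.set0Pn; exists finset.set0; apply/shatP => xi; exists h; first by split.
by move=> i; rewrite inE.
Qed.

(** Expand the product of N factors 1 + a, with [I] the set of factors that contribute 1. *)
Lemma sum_pow_setC N a : (\sum_(I : {set 'I_N}) a ^ (N - #|I|) = a.+1 ^ N)%N.
Proof.
rewrite -[in RHS](card_ord N) -prod_nat_const.
rewrite (eq_bigr (fun=> 1 + a)%N)// bigA_distr; apply: eq_big => [I|I _].
  by rewrite inE.
rewrite (bigID (mem I))/= [X in (_ = X * _)%N]big1 ?mul1n; last by move=> i ->.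
rewrite (eq_bigr (fun=> a)); last by move=> i /negPf ->.
by rewrite prod_nat_const -{1}(card_ord N) -(cardC (mem I)) addKn.
Qed.

(** This fixes the block length 32 d: its d-th power bounds the number of shattered sets by 2 ^ (8
    d), hence the mistakes by a quarter of the block. *)
Lemma pow_17_16 : (17 ^ 32 <= 2 ^ 8 * 16 ^ 31)%N.
Proof. lia. Qed.

Variables (H : set (phyp X)) (d : nat).
Hypothesis VC_le : forall N (p : 'I_N -> X) I, I \in shat p H -> (#|I| <= d)%N.

(* Sauer's bound, with each set of size i weighted by 16 ^ (N - i). *)
Lemma card_shat_le (p : 'I_(32 * d) -> X) : (#|shat p H| <= 2 ^ (8 * d))%N.
Proof.
have : (#|shat p H| * 16 ^ (31 * d) <= 17 ^ (32 * d))%N.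
  rewrite -(sum_pow_setC _ 16) -sum_nat_const big_mkcond; apply: leq_sum => I _.
  by case: ifP => // /VC_le Id; rewrite leq_exp2l//; lia.
have : (17 ^ (32 * d) <= 2 ^ (8 * d) * 16 ^ (31 * d))%N.
  have [->|d0] := posnP d; first by rewrite !muln0.
  by rewrite !expnM -expnMn (leq_exp2r _ _ d0) pow_17_16.
have := expn_gt0 16 (31 * d); set P := (16 ^ _)%N => P0 h1 h2.
by rewrite -(leq_pmul2r (m := P))//; exact: leq_trans h2 h1.
Qed.

Lemma mistakes_le (p : 'I_(32 * d) -> X) (y : 'I_(32 * d) -> bool) (h : phyp X) :
  H h -> (forall j, h (p j) = Some (y j)) -> (mistakes H p y <= 8 * d)%N.
Proof.
move=> Hh hp; rewrite -(@leq_exp2l 2)//.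
exact: leq_trans (halving_mistakes Hh hp) (card_shat_le p).
Qed.

(** * Weak learner: averaging the mistake bound over random blocks *)

Section WeakLearner.
Variables (m : nat) (z : 'I_m -> X * bool).
Local Notation N := (32 * d)%N.

(** The code [k] lists a block of sample indices, repetitions allowed, together with the position
    [k.2] that the test point takes. *)
Definition weak (k : {ffun 'I_N -> 'I_m} * 'I_N) (x : X) : bool :=
  halving H (fun j => (z (k.1 j)).1) (fun j => (z (k.1 j)).2) k.2 x.

Let miss k (i : 'I_m) : R := (weak k (z i).1 != (z i).2)%:R.

Let updf (k : {ffun 'I_N -> 'I_m}) t i : {ffun 'I_N -> 'I_m} := [ffun j => upd k t i j].

Let swap t (u : {ffun 'I_N -> 'I_m} * 'I_m) := (updf u.1 t u.2, u.1 t).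

Let swapK t : involutive (swap t).
Proof.
move=> [k i]; rewrite /swap /=; congr (_, _); last by rewrite ffunE /upd eqxx.
by apply/ffunP => j; rewrite !ffunE /upd; case: eqP => [->|]; rewrite // ffunE /upd => /eqP/negPf ->.
Qed.

Let weak_updf k t i x : weak (updf k t i, t) x = weak (k, t) x.
Proof. by apply: halving_upd => j /negPf jt; rewrite /= ffunE /upd jt. Qed.

Variables (h : phyp X) (w : 'I_m -> R).
Hypothesis Hh : H h.
Hypothesis w_ge0 : forall i, 0 <= w i.
Hypothesis w_supp : forall i, w i != 0 -> h (z i).1 = Some (z i).2.

Let W := \sum_i w i.
Let P (k : {ffun 'I_N -> 'I_m}) := \prod_j w (k j).

Let P_ge0 k : 0 <= P k. Proof. exact: prodr_ge0. Qed.

Let sumP : \sum_k P k = W ^+ N.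
Proof.
rewrite (_ : W ^+ N = \prod_(j < N) W); last by rewrite prodr_const card_ord.
by rewrite /W bigA_distr_bigA.
Qed.

(** Exchanging [k t] with [i] preserves the weight [P k * w i] and the predictor, so the error on a
    fresh draw is the error of the online run on its own [t]-th point. *)
Let sum_miss_swap t :
  \sum_k P k * \sum_i w i * miss (k, t) i = W * \sum_k P k * miss (k, t) (k t).
Proof.
rewrite mulrC big_distrl/=.
under eq_bigr do rewrite big_distrr/=.
under [in RHS]eq_bigr do rewrite big_distrr/=.
rewrite !pair_big/= (reindex_inj (can_inj (swapK t))).
apply: eq_bigr => -[k i] _ /=; rewrite /miss weak_updf mulrA [RHS]mulrAC; congr (_ * _).
rewrite /P (bigD1 t)//= [in RHS](bigD1 t)//= ffunE /upd eqxx.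
rewrite [RHS]mulrC mulrA [RHS]mulrAC; congr (_ * _ * _).
by apply: eq_bigr => j /negPf jt; rewrite ffunE /upd jt.
Qed.

Let sum_miss_le k : P k * \sum_t miss (k, t) (k t) <= P k * (8 * d)%:R.
Proof.
have [->|Pk] := eqVneq (P k) 0; first by rewrite !mul0r.
have hk j : h (z (k j)).1 = Some (z (k j)).2.
  apply: w_supp; move: Pk; rewrite /P prodf_seq_neq0 => /allP /(_ j).
  by rewrite mem_index_enum; apply.
apply: ler_wpM2l => //; rewrite /miss -natr_sum ler_nat.
exact: (mistakes_le (p := fun j => (z (k j)).1) (y := fun j => (z (k j)).2) Hh hk).
Qed.

(** If every code had error above W / 4, the sum over blocks and positions of [P k] times (error - W
    / 4) would be positive; the mistake bound 8 d = N / 4 makes it at most 0. *)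
Lemma weak_learner : (0 < d)%N -> (0 < m)%N ->
  exists k, \sum_i w i * miss k i <= W / 4.
Proof.
move=> d0 m0; apply: contrapT => /forallNP no.
have gt k t : W / 4 < \sum_i w i * miss (k, t) i by rewrite ltNge; apply/negP/no.
have N0 : (0 < N)%N by rewrite muln_gt0.
have [[i0 wi0]|w0] := pselect (exists i, w i != 0); last first.
  have := gt [ffun=> Ordinal m0] (Ordinal N0).
  have {}w0 i : w i = 0 by apply/eqP; apply: contrapT => /negP wi; apply: w0; exists i.
  rewrite /W big1 ?mul0r; last by move=> i _; exact: w0.
  rewrite big1 ?ltxx; last by move=> i _; rewrite w0 mul0r.
  by [].
have sum_le0 : \sum_t \sum_k P k * (\sum_i w i * miss (k, t) i - W / 4) <= 0.
  rewrite (eq_bigr (fun t => W * \sum_k P k * miss (k, t) (k t) - W / 4 * W ^+ N)); last first.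
    move=> t _; under eq_bigr do rewrite mulrBr.
    by rewrite sumrB sum_miss_swap -mulr_suml sumP [X in _ - X]mulrC.
  rewrite sumrB -mulr_sumr exchange_big/= sumr_const card_ord subr_le0.
  have W0 : 0 <= W by exact: sumr_ge0.
  apply: le_trans (ler_wpM2l W0 _) _.
    by apply: ler_sum => k _; rewrite -mulr_sumr; exact: sum_miss_le.
  rewrite -mulr_suml sumP -[X in _ <= X]mulr_natr.
  rewrite (_ : (32 * d)%:R = 4 * (8 * d)%:R :> R); last by rewrite -natrM mulnA.
  rewrite le_eqVlt; apply/orP; left; apply/eqP; by field.
(* The block that repeats [i0] has positive weight, so one term is strictly positive. *)
pose k0 : {ffun 'I_N -> 'I_m} := [ffun=> i0].
have : 0 < \sum_t \sum_k P k * (\sum_i w i * miss (k, t) i - W / 4).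
  rewrite (bigD1 (Ordinal N0))//= (bigD1 k0)//=.
  rewrite -addrA ltr_pwDl//.
    rewrite mulr_gt0 ?subr_gt0 ?gt//; apply: prodr_gt0 => j _.
    by rewrite ffunE lt0r wi0 w_ge0.
  rewrite addr_ge0//.
    by apply: sumr_ge0 => k _; rewrite mulr_ge0// subr_ge0 ltW.
  by apply: sumr_ge0 => t _; apply: sumr_ge0 => k _; rewrite mulr_ge0// subr_ge0 ltW.
by rewrite ltNge sum_le0.
Qed.
End WeakLearner.
End Halving.

(** * Boosting and compression *)

Lemma pow_7_8 : (2 * 7 ^ 6 < 8 ^ 6)%N.
Proof. lia. Qed.

Section Boosting.
Variables (K : Type) (m : nat) (e : K -> 'I_m -> bool) (G : pred 'I_m).

(* Multiplicative weights: each mistake multiplies the weight of a point by 4. *)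
Lemma boosting T :
  (forall w : 'I_m -> R, (forall i, 0 <= w i) -> (forall i, w i != 0 -> G i) ->
     exists k, \sum_i w i * (e k i)%:R <= (\sum_i w i) / 4) ->
  exists ks : T.-tuple K,
    \sum_(i | G i) 4 ^+ count (e^~ i) ks <= m%:R * (7/4) ^+ T :> R.
Proof.
move=> weak; elim: T => [|T [ks IH]].
  exists [tuple]; rewrite /= expr0 mulr1 sumr_const ler_nat.
  by rewrite -[X in (_ <= X)%N]card_ord max_card.
pose w i : R := if G i then 4 ^+ count (e^~ i) ks else 0.
have [i|i|k] := weak w.
- by rewrite /w; case: ifP => // _; rewrite exprn_ge0.
- by rewrite /w; case: ifP => //; rewrite eqxx.
have Ww : \sum_i w i = \sum_(i | G i) 4 ^+ count (e^~ i) ks by rewrite [RHS]big_mkcond.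
move=> wk; exists [tuple of k :: ks].
(* 4 ^ (c + e) = 4 ^ c (1 + 3 e) for e = 0 or 1; an error of at most a quarter of the weight gives
   the growth factor 1 + 3/4. *)
have -> : \sum_(i | G i) 4 ^+ count (e^~ i) [tuple of k :: ks]
    = \sum_i w i + 3 * \sum_i w i * (e k i)%:R :> R.
  rewrite mulr_sumr -big_split big_mkcond/=; apply: eq_bigr => i _; rewrite /w.
  case: ifP => _; last by rewrite mul0r mulr0 addr0.
  case: (e k i) => /=; rewrite ?exprS; ring.
rewrite exprS mulrCA -Ww in IH *; lra.
Qed.

(** A point of [G] missed by at least half of the voters contributes at least 2 ^ T to the
    potential, more than m (7/4) ^ T allows. *)
Lemma boosting_majority T : (m * 7 ^ T < 8 ^ T)%N ->
  (forall w : 'I_m -> R, (forall i, 0 <= w i) -> (forall i, w i != 0 -> G i) ->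
     exists k, \sum_i w i * (e k i)%:R <= (\sum_i w i) / 4) ->
  exists ks : T.-tuple K, forall i, G i -> (2 * count (e^~ i) ks < T)%N.
Proof.
move=> mT /(boosting T)[ks ksP]; exists ks => i Gi; rewrite ltnNge; apply/negP => Tc.
have : 2 ^+ T <= m%:R * (7/4) ^+ T :> R.
  apply: le_trans ksP; rewrite (bigD1 i)//=; apply: ler_wpDr.
    by apply: sumr_ge0 => j _; rewrite exprn_ge0.
  have -> : 4 = 2 ^+ 2 :> R by rewrite -natrX.
  by rewrite -exprM ler_weXn2l// ler1n.
rewrite expr_div_n mulrA ler_pdivlMr ?exprn_gt0// -exprMn.
have -> : 2 * 4 = 8 :> R by rewrite -natrM.
by rewrite -!natrX -natrM ler_nat leqNgt mT.
Qed.

End Boosting.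

(* 6 l rounds of boosting suffice for 2 ^ l points since (8/7) ^ 6 > 2. *)
Local Notation voters d l :=
  ((6 * l).-tuple ({ffun 'I_(32 * d) -> 'I_(2 ^ l)} * 'I_(32 * d))).

Section Compression.
Variables (X : Type) (H : set (phyp X)) (d l : nat).

Definition reconstruct (z : 'I_(2 ^ l) -> X * bool) (ks : voters d l) (x : X) : bool :=
  (6 * l < 2 * count (fun k => weak H z k x) ks)%N.

Definition voters_support (ks : voters d l) : {set 'I_(2 ^ l)} :=
  [set i : 'I_(2 ^ l) | has (fun k : {ffun 'I_(32 * d) -> 'I_(2 ^ l)} * 'I_(32 * d) =>
                              [exists j, k.1 j == i]) ks]%SET.

Lemma card_voters_support ks : (#|voters_support ks| <= 6 * l * (32 * d))%N.
Proof.
pose s := flatten [seq codom k.1 | k : {ffun 'I_(32 * d) -> 'I_(2 ^ l)} * 'I_(32 * d) <- ks].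
have -> : (6 * l * (32 * d) = size s)%N.
  rewrite size_flatten /shape -map_comp sumnE big_map.
  rewrite (eq_bigr (fun=> 32 * d)%N) => [|k _]; last by rewrite /= size_codom card_ord.
  by rewrite big_const_seq count_predT iter_addn_0 size_tuple mulnC.
apply: leq_trans (card_size s); apply: subset_leq_card; apply/fintype.subsetP => i.
rewrite inE => /hasP[k kks /existsP[j /eqP <-]]; apply/flatten_mapP.
by exists k => //; exact: codom_f.
Qed.

(** This is the independence that [deviation] requires, with [J] the sample indices named by the
    code. *)
Lemma reconstruct_upd (z : 'I_(2 ^ l) -> X * bool) i t ks :
  i \notin voters_support ks -> reconstruct (upd z i t) ks =1 reconstruct z ks.
Proof.
rewrite inE -all_predC => /allP ik x; rewrite /reconstruct; congr (_ < 2 * _)%N.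
apply: eq_in_count => k /ik /=; rewrite negb_exists => /forallP kj.
have kji j : upd z i t (k.1 j) = z (k.1 j) by rewrite /upd (negPf (kj j)).
by rewrite /weak; apply: halving_upd => j _; rewrite kji.
Qed.

(** The position of the test point counts as one more sample index since 32 d <= 2 ^ l, so a voter
    costs at most 33 d l bits and the 6 l voters 198 d l ^ 2. *)
Lemma card_voters : (0 < d)%N -> (0 < l)%N -> (32 * d <= 2 ^ l)%N ->
  (#|{: voters d l}| <= 2 ^ (198 * d * l ^ 2))%N.
Proof.
move=> d0 l0 dl; rewrite card_tuple card_prod card_ffun !card_ord.
apply: (@leq_trans (((2 ^ l) ^ (33 * d)) ^ (6 * l))%N).
  rewrite leq_exp2r ?muln_gt0 ?l0//; apply: leq_trans (leq_mul (leqnn _) dl) _.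
  rewrite -expnSr leq_pexp2l ?expn_gt0//; lia.
by rewrite -!expnM; apply: eq_leq; congr (2 ^ _)%N; nia.
Qed.

Hypothesis VC_le : forall N (p : 'I_N -> X) I, I \in shat p H -> (#|I| <= d)%N.

(** Every weighting carried by the points where [h] is right has a weak predictor, so boosting on
    these points yields a correct majority; the other sample points are never weighted. *)
Lemma compression (z : 'I_(2 ^ l) -> X * bool) (h : phyp X) :
  (0 < d)%N -> (0 < l)%N -> H h ->
  exists ks, forall i, h (z i).1 = Some (z i).2 -> reconstruct z ks (z i).1 = (z i).2.
Proof.
move=> d0 l0 Hh.
pose e (k : {ffun 'I_(32 * d) -> 'I_(2 ^ l)} * 'I_(32 * d)) (i : 'I_(2 ^ l)) := weak H z k (z i).1 != (z i).2.
pose G (i : 'I_(2 ^ l)) := h (z i).1 == Some (z i).2.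
have mT : (2 ^ l * 7 ^ (6 * l) < 8 ^ (6 * l))%N.
  rewrite !(expnM _ 6) -expnMn (ltn_exp2r _ _ l0); exact: pow_7_8.
have [w w0 wG|ks ksP] := boosting_majority (e := e) (G := G) mT.
  by apply: (weak_learner VC_le Hh w0) => // [i /wG /eqP//|]; rewrite expn_gt0.
exists ks => i /eqP /ksP; rewrite /reconstruct; case yi: (z i).2.
  rewrite [X in (_ < 2 * X)%N](@eq_count _ _ (predC (e^~ i))); last first.
    by move=> k; rewrite /= /e yi negbK eqb_id.
  have := count_predC (e^~ i) ks; rewrite size_tuple.
  set a := count _ _; set b := count _ _; lia.
rewrite (@eq_count _ (fun k => weak H z k (z i).1) (e^~ i)); last first.
  by move=> k; rewrite /e yi; case: weak.
by move=> /ltnW /leq_gtF.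
Qed.

End Compression.

(** * The learner *)

Lemma union_bound (T : choiceType) (mu : T -> R) (K : finType) (A A0 : set T)
    (E : K -> set T) : is_pmf mu ->
  (forall t, A t -> A0 t \/ exists k, E k t) ->
  prob mu A <= prob mu A0 + \sum_k prob mu (E k).
Proof.
move=> muP cover; rewrite -lee_fin EFinD -sumEFin !probK//.
under eq_bigr do rewrite probK// ProbE.
rewrite !ProbE -expectation_sum//.
rewrite -expectationD//; last by move=> t; apply: sume_ge0 => k _; rewrite lee_fin.
apply: le_expectation => // t; rewrite sumEFin -EFinD lee_fin.
have ge0 : 0 <= \sum_k (t \in E k)%:R :> R by apply: sumr_ge0.
have [/set_mem /cover [/mem_set ->|[k /mem_set tk]]|_] := boolP (t \in A).
- by rewrite lerDl.
- rewrite addrC (bigD1 k)//= tk -addrA lerDl addr_ge0//.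
  exact: sumr_ge0.
- by rewrite addr_ge0.
Qed.

Section Upper.
Variables (X : Type) (S B : set (phyp X)).

Definition agree (s b : phyp X) : phyp X := fun x => if s x == b x then s x else None.

Definition agreement : set (phyp X) :=
  [set a | exists s b, [/\ S s, B b & a = agree s b]].

Lemma agreeP s b x y : agree s b x = Some y <-> s x = Some y /\ b x = Some y.
Proof.
rewrite /agree; case: eqP => [<-|sb]; first by split=> [|[]].
by split=> // -[sx bx]; case: sb; rewrite sx bx.
Qed.

Lemma shat_agreement_mutualVC N (p : 'I_N -> X) (I : {set 'I_N}) :
  I \in shat p agreement -> ((#|I|)%:R%:E <= mutualVC S B)%E.
Proof.
move=> /shatP sI; pose l : seq {classic X} := [seq p i | i <- enum I].
have sIx xi : exists s b, [/\ S s, B b & forall i, i \in I ->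
    s (p i) = Some (xi (p i)) /\ b (p i) = Some (xi (p i))].
  have [h [s [b [Ss Bb ->]]] hI] := sI (xi \o p).
  by exists s, b; split=> // i /hI /agreeP.
apply: ereal_sup_ubound; exists l; last by rewrite size_map -cardE.
split.
  rewrite map_inj_in_uniq ?enum_uniq// => i j; rewrite !mem_enum => iI jI pij.
  (* The labelling that is [true] only at [i] forces [j = i] when [p i = p j]. *)
  have [h _ hI] := sI (fun k => k == i).
  have := hI j jI; rewrite -pij (hI i iI) eqxx => -[].
  by move/esym/eqP.
split=> xi.
  have [s [b [Ss _ sb]]] := sIx xi; exists s => // x /mapP[i].
  by rewrite mem_enum => /sb[+ _] ->.
have [s [b [_ Bb sb]]] := sIx xi; exists b => // x /mapP[i].
by rewrite mem_enum => /sb[_ +] ->.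
Qed.

Definition point_mass n (F : ('I_n -> Pt X) -> model X) : learner X n :=
  fun z f => (f == F z)%:R.

Lemma point_massP n (F : ('I_n -> Pt X) -> model X) : valid_learner (point_mass F).
Proof.
move=> z; apply/is_pmfP; split=> // ; rewrite /point_mass.
transitivity (\esum_(f in [set F z]) (1%:E : \bar R))%E; last by rewrite esum_set1.
rewrite [RHS]esum_mkcond; apply: eq_esum => f _.
by case: eqP => [->|ne]; [rewrite mem_set | rewrite memNset].
Qed.

Lemma Prob_point_mass n (F : ('I_n -> Pt X) -> model X) z (E : set (model X)) :
  Prob (point_mass F z) E = (F z \in E)%:R%:E.
Proof.
have PP := point_massP F z.
have [/set_mem FE|FE] := boolP (F z \in E).
  apply/eqP; rewrite eq_le Prob_le1//=.
  rewrite -(proj2 PP); apply: le_trans (le_Prob PP (E := [set F z]) _); last by move=> _ ->.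
  rewrite /Prob [X in (_ <= X)%E]esum_mkcond; apply: le_esum => f _.
  by rewrite /point_mass; case: eqP => [->|ne]; [rewrite mem_set | rewrite memNset].
rewrite /Prob esum1// => f Ef; rewrite /point_mass; case: eqP => // fF.
by case/negP: FE; apply/mem_set; rewrite -fF.
Qed.

Lemma CompL_deterministic n (F : ('I_n -> Pt X) -> model X) (eps delta : R) :
  (forall mu : Pt X -> R, is_pmf mu -> realizable S mu ->
     prob (@prodpmf _ mu n)
       [set z | ~~ (err_model mu (F z) <= opt_err B mu + eps%:E)%E] <= delta) ->
  CompL n S B eps delta.
Proof.
move=> FP; exists (point_mass F); split; first exact: point_massP.
move=> mu muP rmu; have PP := prodpmfP muP n; have := FP mu muP rmu.
set bad := [set z | _] => badP.
have -> : success_prob B eps (point_mass F) mu = Prob (@prodpmf _ mu n) (~` bad).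
  rewrite ProbE; apply: eq_esum => z _; rewrite Prob_point_mass; congr (_ * _%:R%:E)%E.
  rewrite in_setC; congr nat_of_bool; apply/idP/idP.
    by move=> /set_mem le; apply/negP => /set_mem /negP; apply.
  by move=> /negP nb; apply/mem_set; apply: contrapT => /negP nle; apply/nb/mem_set.
by rewrite -probK// prob_setC// lee_fin lerD2l lerN2.
Qed.

Definition errs (f : model X) : set (Pt X) := [set z | f z.1 <> z.2].

(** The infimum over [B] may not be attained, hence the slack [eps]; as [s] is right almost surely,
    [agree s b] errs only where [b] errs, up to a null set. *)
Lemma agree_opt (mu : Pt X -> R) (eps : R) : is_pmf mu -> realizable S mu ->
  B !=set0 -> 0 < eps ->
  exists2 a, agreement a &
    ((prob mu [set z | a z.1 <> Some z.2])%:E <= opt_err B mu + eps%:E)%E.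
Proof.
move=> muP [s Ss sP] [b0 Bb0] eps0.
have opt_ge0 : (0 <= opt_err B mu)%E.
  by apply: le_ereal_inf_tmp => _ [b _ <-]; exact: Prob_ge0.
have opt_le1 : (opt_err B mu <= 1)%E.
  by apply: (@le_trans _ _ (err_hyp mu b0)); [apply: ereal_inf_lbound; exists b0|exact: Prob_le1].
have opt_fin : opt_err B mu \is a fin_num.
  by rewrite ge0_fin_numE//; exact: le_lt_trans opt_le1 (ltry _).
have [_ [b Bb <-] /ltW bo] := lb_ereal_inf_adherent eps0 opt_fin.
exists (agree s b); first by exists s, b.
apply: le_trans bo; rewrite /err_hyp -(probK muP) lee_fin.
have s0 : prob mu (~` [set z : Pt X | s z.1 = Some z.2]) = 0.
  by rewrite prob_setC// /prob sP subrr.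
pose E (k : 'I_1) := ~` [set z : Pt X | s z.1 = Some z.2].
apply: le_trans (union_bound (A0 := [set z : Pt X | b z.1 <> Some z.2]) (E := E) muP _) _.
  move=> z /= az; have [bz|] := pselect (b z.1 = Some z.2); last by left.
  by right; exists ord0 => sz; apply: az; apply/agreeP.
by rewrite big_ord1 s0 addr0.
Qed.

(** No point is shattered by [agreement], so all its members defined at [x] give the same label
    there. Predicting that label needs no sample and errs only where every member errs. *)
Lemma CompL_VC0 (eps delta : R) : mutualVC S B = 0%:E -> S !=set0 -> B !=set0 ->
  0 < eps -> 0 < delta -> CompL 0 S B eps delta.
Proof.
move=> VC0 S0 B0 eps0 delta0.
pose F (_ : 'I_0 -> Pt X) : model X := fun x => `[< exists2 a, agreement a & a x = Some true >].
have FP z a x y : agreement a -> a x = Some y -> F z x = y.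
  move=> Aa ax; apply/asboolP; case: y ax => [ax|ax]; first by exists a.
  move=> [a' Aa' ax'].
  pose I := [set: 'I_1]%SET.
  have : I \in shat (fun=> x) agreement.
    apply/shatP => xi; case xi0: (xi ord0); [exists a'|exists a] => // i _;
      by rewrite (ord1 i) xi0.
  by move/shat_agreement_mutualVC; rewrite VC0 cardsT card_ord lee_fin ler10.
apply: (@CompL_deterministic _ F) => mu muP rmu.
rewrite (_ : [set z | _] = classical_sets.set0) /prob; first by rewrite /Prob esum_set0 ltW.
apply/seteqP; split=> // z /=; apply/negP; rewrite negbK.
have [a Aa aopt] := agree_opt muP rmu B0 eps0.
apply: le_trans aopt; rewrite probK//; apply: le_Prob => // t /= tF ta.
by apply: tF; exact: FP ta.
Qed.

Variables (d l : nat) (eps delta : R).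
Local Notation m := (2 ^ l)%N.
Hypothesis VC_d : mutualVC S B = d%:R%:E.
Hypothesis d_gt0 : (0 < d)%N.
Hypothesis l_gt0 : (0 < l)%N.
Hypothesis eps_bound : 0 < eps < 2.
(** Sample points named by a code escape the deviation bound; they make up at most a fraction eps /
    4 of the sample. *)
Hypothesis support_le : (6 * l * (32 * d))%:R <= eps / 4 * m%:R.
(** Union bound over all codes, plus one event for the competitor. *)
Hypothesis failure_le :
  (2 ^ (198 * d * l ^ 2) + 1)%:R * expR (- ((eps / 4) ^+ 2 / 2 * m%:R)) <= delta.

Let VC_le N (p : 'I_N -> X) I : I \in shat p agreement -> (#|I| <= d)%N.
Proof. by move/shat_agreement_mutualVC; rewrite VC_d lee_fin ler_nat. Qed.

Let dec (z : 'I_m -> Pt X) ks : model X := reconstruct agreement (d := d) z ks.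

Let emp (z : 'I_m -> Pt X) ks := #|[set i | dec z ks (z i).1 != (z i).2]%SET|.

Let voters0 : {: voters d l}.
Proof.
have d32 : (0 < 32 * d)%N by rewrite muln_gt0.
have m0 : (0 < m)%N by rewrite expn_gt0.
exact: [tuple of nseq _ ([ffun=> Ordinal m0], Ordinal d32)].
Qed.

Let ERM (z : 'I_m -> Pt X) : model X := dec z [arg min_(ks < voters0) emp z ks].

Let F_dec ks (z : 'I_m -> Pt X) := errs (dec z ks).

Let F_dec_upd ks z i t : i \notin voters_support ks -> F_dec ks (upd z i t) = F_dec ks z.
Proof.
move=> iks; rewrite /F_dec /errs /dec; apply/seteqP.
by split=> u /=; rewrite (reconstruct_upd agreement z t iks).
Qed.

Let theta := eps / 4.

(** Both events are instances of [deviation]: in [bad] the true error of a decoded predictor is too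
    far above its empirical error outside its support; in [bad0], with [l = - theta], a fixed event
    is too frequent in the sample. *)
Let bad (mu : Pt X -> R) ks := [set z : 'I_m -> Pt X | theta ^+ 2 * m%:R <=
  theta * \sum_(i | i \notin voters_support ks) (prob mu (F_dec ks z) - (z i \in F_dec ks z)%:R)].

Let bad0 (mu : Pt X -> R) (E : set (Pt X)) := [set z : 'I_m -> Pt X | (- theta) ^+ 2 * m%:R <=
  - theta * \sum_(i | i \notin finset.set0) (prob mu E - (z i \in E)%:R)].

Let theta_le : `|theta| <= 1/2.
Proof. by rewrite /theta; case/andP: eps_bound => e0 e1; rewrite gtr0_norm; lra. Qed.

(** Three slacks of theta: the empirical error of the competitor, the coordinates in the support,
    and the deviation outside it. Compression provides a code whose empirical error is at most that
    of [a], and the minimizer does no worse. *)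
Let good_ERM mu a z : is_pmf mu -> agreement a ->
  ~ bad0 mu [set u | a u.1 <> Some u.2] z -> (forall ks, ~ bad mu ks z) ->
  prob mu (errs (ERM z)) <= prob mu [set u | a u.1 <> Some u.2] + 3 * theta.
Proof.
move=> muP Aa; set Ea := [set u | _]; rewrite /ERM.
case: arg_minnP => //= ks _ ks_min nb0 /(_ ks) nb.
have th0 : 0 < theta by rewrite /theta; case/andP: eps_bound => e0 e1; lra.
have m_gt0 : 0 < m%:R :> R by rewrite ltr0n expn_gt0.
set pk := prob mu (errs _); set pa := prob mu Ea.
have pk1 : pk <= 1 := prob_le1 muP _.
have [ka kaP] := compression VC_le z d_gt0 l_gt0 Aa.
have emp_le : (emp z ks <= #|[set i | z i \in Ea]%SET|)%N.
  apply: leq_trans (ks_min ka isT) _; apply: subset_leq_card; apply/fintype.subsetP => i.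
  rewrite !finset.in_set => ne; apply/mem_set => /= ai; move: ne; rewrite /dec kaP ?eqxx//.
have sumEa : \sum_(i | i \notin finset.set0) (pa - (z i \in Ea)%:R)
    = m%:R * pa - #|[set i | z i \in Ea]%SET|%:R.
  rewrite (eq_bigl xpredT); last by move=> i; rewrite inE.
  have -> : m%:R * pa = \sum_(i < m) pa by rewrite sumr_const card_ord mulr_natl.
  rewrite sumrB -natr_sum; congr (_ - _%:R).
  by rewrite -sum1dep_card [RHS]big_mkcond/=; apply: eq_bigr => i _; case: (_ \in _).
have h0 : #|[set i | z i \in Ea]%SET|%:R < theta * m%:R + m%:R * pa.
  move/negP: nb0; rewrite -ltNge -/pa sumEa sqrrN expr2 -mulrA mulNr -mulrN.
  by rewrite (ltr_pM2l th0); lra.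
set J := voters_support ks.
have h1 : \sum_(i | i \notin J) (pk - (z i \in F_dec ks z)%:R) < theta * m%:R.
  by move/negP: nb; rewrite -ltNge -/pk expr2 -mulrA (ltr_pM2l th0).
have JcE : (#|[pred i | i \notin J]| = m - #|J|)%N.
  by have := cardC (mem J); rewrite card_ord => /(congr1 (subn^~ #|J|)); rewrite addKn.
have Jm : (#|J| <= m)%N by rewrite -[X in (_ <= X)%N]card_ord max_card.
have h2 : (m%:R - #|J|%:R) * pk - (emp z ks)%:R <=
    \sum_(i | i \notin J) (pk - (z i \in F_dec ks z)%:R).
  rewrite sumrB sumr_const JcE -[_ *+ (m - _)]mulr_natl natrB// lerD2l lerN2 -natr_sum ler_nat.
  rewrite /emp -sum1dep_card [X in (_ <= X)%N]big_mkcond/= [X in (X <= _)%N]big_mkcond/=.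
  apply: leq_sum => i _; case: (i \notin J) => //.
  case: (boolP (_ \in F_dec _ _)) => // /set_mem; rewrite /F_dec /errs /=.
  by move=> /eqP ->.
have h3 : #|J|%:R <= theta * m%:R.
  by apply: le_trans support_le; rewrite ler_nat; exact: card_voters_support.
have h4 : (emp z ks)%:R <= #|[set i | z i \in Ea]%SET|%:R :> R by rewrite ler_nat.
have h5 : #|J|%:R * pk <= #|J|%:R by rewrite ler_piMr.
rewrite -(ler_pM2l m_gt0); nra.
Qed.

Lemma CompL_upper : CompL m S B eps delta.
Proof.
have [eps0 eps2] := andP eps_bound.
have th0 : 0 < theta by rewrite /theta; lra.
(* [B] is non-empty: otherwise [mutualVC] would be a supremum over the empty set, that is -oo. *)
have [B0|/set0P/negP] := pselect (B !=set0); last first.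
  rewrite negbK => /eqP B0; move: VC_d; rewrite /mutualVC.
  rewrite (_ : [set _ | _ in _] = classical_sets.set0) ?ereal_sup0//.
  by apply/seteqP; split=> // x [l' [_ [_ /(_ (fun=> true))[b]]]]; rewrite B0.
apply: (@CompL_deterministic _ ERM) => mu muP rmu.
have [a Aa aopt] := agree_opt muP rmu B0 th0.
have PP := prodpmfP muP m.
set Ea := [set u | a u.1 <> Some u.2] in aopt.
apply: le_trans (union_bound (A0 := bad0 mu Ea) (E := bad mu) PP _) _.
  move=> z /negP nle; apply: contrapT => /not_orP[nb0 /forallNP nb]; apply: nle.
  rewrite /err_model -(probK muP).
  apply: (@le_trans _ _ (prob mu Ea + 3 * theta)%:E).
    by rewrite lee_fin; exact: good_ERM.
  rewrite EFinD; apply: le_trans (leeD aopt (lexx _)) _.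
  by rewrite -addeA -EFinD (_ : theta + 3 * theta = eps)// /theta; lra.
have hb ks : prob (@prodpmf _ mu m) (bad mu ks) <= expR (- (theta ^+ 2 / 2 * m%:R)).
  by apply: deviation => //; move=> *; exact: F_dec_upd.
have hb0 : prob (@prodpmf _ mu m) (bad0 mu Ea) <= expR (- (theta ^+ 2 / 2 * m%:R)).
  rewrite -[theta ^+ 2]sqrrN; apply: (@deviation _ mu muP m (fun=> Ea) finset.set0) => //.
  by rewrite normrN.
apply: le_trans failure_le; rewrite natrD mulrDl mul1r addrC.
apply: lerD; last exact: hb0.
apply: le_trans (ler_sum _ (fun ks _ => hb ks)) _.
rewrite sumr_const -[X in X <= _]mulr_natl; apply: ler_wpM2r; first exact: expR_ge0.
rewrite ler_nat; apply: card_voters => //.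
rewrite -(ler_nat R); apply: (@le_trans _ _ (6 * l * (32 * d))%:R).
  rewrite ler_nat; nia.
apply: le_trans support_le _.
by rewrite -[X in _ <= X]mul1r ler_wpM2r//; lra.
Qed.
End Upper.

(** * Random labellings of a shattered set *)

Lemma esum_finite_support (T : choiceType) (K : finType) (e : K -> T) (f : T -> \bar R) :
  injective e -> (forall t, 0 <= f t)%E -> (forall t, (forall k, t <> e k) -> f t = 0%E) ->
  (\esum_(t in [set: T]) f t = \sum_k f (e k))%E.
Proof.
move=> ei f0 fe.
transitivity (\esum_(t in range e) f t)%E.
  rewrite [RHS]esum_mkcond; apply: eq_esum => t _; case: ifPn => // /negP te.
  by apply: fe => k tk; apply: te; apply/mem_set; exists k.
rewrite esum_image; last by move=> i j _ _; exact: ei.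
rewrite esum_fset//; last exact: finite_finset.
rewrite [RHS]fsbig_seq ?index_enum_uniq//.
suff -> : [set` index_enum K] = [set: K] by [].
by apply/seteqP; split=> // t _; rewrite /= mem_index_enum.
Qed.

Section LowerBound.
Variables (X : Type) (S B : set (phyp X)) (n : nat) (eps delta : R).
Hypothesis eps_gt0 : 0 < eps.
Hypothesis learnable : CompL n S B eps delta.
Variables (k : nat) (x : 'I_k -> X) (p : 'I_k -> R).
Hypothesis x_inj : injective x.
Hypothesis S_shatters : forall xi : 'I_k -> bool,
  exists2 s, S s & forall i, s (x i) = Some (xi i).
Hypothesis B_shatters : forall xi : 'I_k -> bool,
  exists2 b, B b & forall i, b (x i) = Some (xi i).
Hypothesis p_ge0 : forall i, 0 <= p i.
Hypothesis p_sum : \sum_i p i = 1.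
Implicit Types (xi : {ffun 'I_k -> bool}) (iota : {ffun 'I_n -> 'I_k}).

Let lab xi i : Pt X := (x i, xi i).

Let lab_inj xi : injective (lab xi).
Proof. by move=> i j [/x_inj]. Qed.

Let mu xi (z : Pt X) : R := if [pick i | z == lab xi i] is Some i then p i else 0.

Let muE xi i : mu xi (lab xi i) = p i.
Proof.
rewrite /mu; case: pickP => [j /eqP/lab_inj <-//|/(_ i)]; by rewrite eqxx.
Qed.

Let mu0 xi z : (forall i, z <> lab xi i) -> mu xi z = 0.
Proof. by move=> zi; rewrite /mu; case: pickP => // i /eqP/zi. Qed.

Let mu_ge0 xi z : 0 <= mu xi z.
Proof. by rewrite /mu; case: pickP. Qed.

Let muP xi : is_pmf (mu xi).
Proof.
apply/is_pmfP; split=> //.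
rewrite (esum_finite_support (@lab_inj xi)); last 2 first.
- by move=> z; rewrite lee_fin.
- by move=> z /mu0 ->.
by under eq_bigr do rewrite muE; rewrite sumEFin p_sum.
Qed.

Let Prob_mu xi E : Prob (mu xi) E = (\sum_i p i * (lab xi i \in E)%:R)%:E.
Proof.
rewrite ProbE /expectation (esum_finite_support (@lab_inj xi)); last 2 first.
- by move=> z; rewrite -EFinM lee_fin mulr_ge0.
- by move=> z /mu0 ->; rewrite mul0e.
by rewrite -sumEFin; apply: eq_bigr => i _; rewrite muE.
Qed.

Let realizable_mu xi : realizable S (mu xi).
Proof.
have [s Ss sx] := S_shatters xi; exists s => //; rewrite Prob_mu.
transitivity (\sum_i p i)%:E; last by rewrite p_sum.
by congr EFin; apply: eq_bigr => i _; rewrite mem_set ?mulr1//; exact: sx.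
Qed.

Let opt_mu xi : (opt_err B (mu xi) <= 0)%E.
Proof.
have [b Bb bx] := B_shatters xi; apply: ereal_inf_lbound; exists b => //.
rewrite /err_hyp Prob_mu big1// => i _; rewrite memNset ?mulr0//.
by apply; exact: bx.
Qed.

Definition loss xi (f : model X) : R := \sum_i p i * (f (x i) != xi i)%:R.

Let err_mu xi f : err_model (mu xi) f = (loss xi f)%:E.
Proof.
rewrite /err_model Prob_mu; congr EFin; apply: eq_bigr => i _; congr (_ * _%:R).
by congr nat_of_bool; apply/idP/idP => [/set_mem/eqP|/eqP ?]//; apply/mem_set.
Qed.

Let sample xi iota : 'I_n -> Pt X := fun j => lab xi (iota j).

Let weight iota : R := \prod_j p (iota j).

Let weight_ge0 iota : 0 <= weight iota. Proof. exact: prodr_ge0. Qed.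

Let weight_sum : \sum_iota weight iota = 1.
Proof.
rewrite /weight -(bigA_distr_bigA (fun (j : 'I_n) i => p i)) p_sum.
by rewrite prodr_const expr1n.
Qed.

(** Samples not of the form [sample xi iota] have weight 0, which turns the unordered sum into a
    finite one; the optimum over [B] is 0, so success forces a loss of at most eps. *)
Let failure_sum : exists2 L : learner X n, valid_learner L &
  forall xi, \sum_iota weight iota * prob (L (sample xi iota)) [set f | eps < loss xi f] <= delta.
Proof.
have [L [LP Lsucc]] := learnable; exists L => // xi.
have := Lsucc _ (muP xi) (realizable_mu xi).
rewrite /success_prob (esum_finite_support (e := sample xi)); last 3 first.
- move=> i j ij; apply/ffunP => a.
  by apply: (@lab_inj xi); exact: (congr1 (fun f => f a) ij).
- move=> s; rewrite mule_ge0 ?Prob_ge0// lee_fin; exact: prodr_ge0.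
- move=> s ns; have [[a sa]|/forallNP al] := pselect (exists a, forall i, s a <> lab xi i).
    by rewrite /sample_prob (bigD1 a)//= (mu0 sa) mul0r mul0e.
  have /choice [g gP] : forall a, exists i, s a = lab xi i.
    by move=> a; apply: contrapT => /forallNP sa; exact: al sa.
  by exfalso; apply: (ns (finfun g)); apply/funext => a; rewrite gP /sample ffunE.
move=> succ.
have {succ} : ((1 - delta)%:E <=
    (\sum_iota weight iota * (1 - prob (L (sample xi iota)) [set f | eps < loss xi f]))%:E)%E.
  apply: le_trans succ _; rewrite -sumEFin; apply: lee_sum => iota _; rewrite EFinM.
  have -> : sample_prob (mu xi) (sample xi iota) = weight iota.
    by apply: eq_bigr => a _; rewrite muE.
  apply: lee_wpmul2l; first by rewrite lee_fin.
  rewrite -prob_setC ?probK//; apply: le_Prob => // f /=.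
  rewrite err_mu => le; apply/negP; rewrite -leNgt -lee_fin.
  by apply: le_trans le _; rewrite -[X in (_ <= X)%E]add0e leeD2r.
rewrite lee_fin; under eq_bigr do rewrite mulrBr mulr1.
by rewrite sumrB weight_sum; lra.
Qed.

Let flip (i : 'I_k) xi : {ffun 'I_k -> bool} := [ffun j => if j == i then ~~ xi j else xi j].

Let flipK i : involutive (flip i).
Proof. by move=> xi; apply/ffunP => j; rewrite !ffunE; case: eqP => // _; rewrite negbK. Qed.

(* A point absent from the sample is mislabelled for exactly one of xi and flip i xi. *)
Let unseen_error (L : learner X n) (i : 'I_k) : valid_learner L ->
  2 ^+ k / 2 * (1 - p i) ^+ n <= \sum_(xi : {ffun 'I_k -> bool})
     \sum_iota weight iota * prob (L (sample xi iota)) [set f | f (x i) != xi i].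
Proof.
move=> LP; rewrite exchange_big/=.
have -> : (1 - p i) ^+ n = \sum_(iota in ffun_on (predC1 i)) weight iota.
  rewrite /weight -(bigA_distr_big _ (fun (j : 'I_n) i => p i)).
  have -> : \sum_(a in predC1 i) p a = 1 - p i.
    by rewrite -p_sum [X in X - _](bigD1 i)//= addrAC subrr add0r.
  by rewrite prodr_const card_ord.
rewrite big_distrr [X in _ <= X](bigID (mem (ffun_on (predC1 i))))/=.
apply: ler_wpDr.
  by do 2!apply: sumr_ge0 => ? _; rewrite mulr_ge0// prob_ge0.
apply: ler_sum => iota /ffun_onP iotai; rewrite -mulr_sumr [X in X <= _]mulrC.
apply: ler_wpM2l => //; rewrite le_eqVlt; apply/orP; left; apply/eqP.
set s := \sum_xi _; suff : s + s = 2 ^+ k by lra.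
have -> : 2 ^+ k = \sum_(xi : {ffun 'I_k -> bool}) 1 :> R.
  by rewrite sumr_const card_ffun card_bool card_ord -natrX.
rewrite {2}/s (reindex_inj (can_inj (flipK i))) -big_split/=; apply: eq_bigr => xi _.
have -> : sample (flip i xi) iota = sample xi iota.
  apply/funext => j; rewrite /sample /lab ffunE.
  by have := iotai j; rewrite inE => /negPf ->.
rewrite (_ : [set f | f (x i) != flip i xi i] = ~` [set f : model X | f (x i) != xi i]).
  by rewrite prob_setC//; lra.
apply/seteqP; split=> f /=; rewrite ffunE eqxx; case: (f _); case: (xi i) => //.
Qed.

(** Average the weighted loss over labellings: an unseen point costs half of its weight, while [a]
    bounds the loss of an acceptable model and [a + b] that of any model. *)
Let avg_failure (L : learner X n) (a b : R) (w : 'I_k -> R) : valid_learner L ->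
  0 <= b -> (forall i, 0 <= w i) ->
  (forall xi (f : model X),
     \sum_i w i * (f (x i) != xi i)%:R <= a + b * (eps < loss xi f)%R%:R) ->
  0 <= a ->
  (forall xi, \sum_iota weight iota * prob (L (sample xi iota)) [set f | eps < loss xi f] <= delta) ->
  \sum_i w i * (1 - p i) ^+ n <= 2 * (a + b * delta).
Proof.
move=> LP b0 w0 wab a0 Ldelta.
have le xi iota : \sum_i w i * prob (L (sample xi iota)) [set f | f (x i) != xi i]
    <= a + b * prob (L (sample xi iota)) [set f | eps < loss xi f].
  rewrite -lee_fin -sumEFin EFinD EFinM probK// ProbE.
  under eq_bigr do rewrite EFinM probK// ProbE -expectationZl//.
  rewrite -expectation_sum//; last by move=> i f; rewrite mule_ge0// lee_fin.
  rewrite -expectationZl// -[X in (_ <= X + _)%E](expectation_cst (LP (sample xi iota)))//.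
  rewrite -expectationD//; last by move=> f; rewrite mule_ge0// lee_fin.
  apply: le_expectation => // f; rewrite -EFinM -EFinD.
  under eq_bigr do rewrite -EFinM.
  rewrite sumEFin lee_fin; apply: le_trans (le_trans _ (wab xi f)) _.
    apply: ler_sum => i _; apply: ler_wpM2l => //.
    by case: (boolP (_ \in _)) => [/set_mem /= ->|].
  rewrite lerD2l ler_wpM2l//; case: ltP => // lt_f.
  by rewrite mem_set.
have le_sum xi : \sum_i w i * \sum_iota weight iota *
    prob (L (sample xi iota)) [set f | f (x i) != xi i] <= a + b * delta.
  under eq_bigr do rewrite mulr_sumr.
  rewrite exchange_big/=.
  apply: (@le_trans _ _ (\sum_iota weight iota * (a + b *
      prob (L (sample xi iota)) [set f | eps < loss xi f]))).
    apply: ler_sum => iota _; under eq_bigr do rewrite mulrCA.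
    by rewrite -mulr_sumr ler_wpM2l.
  under eq_bigr do rewrite mulrDr mulrCA.
  rewrite big_split/= -mulr_suml weight_sum mul1r lerD2l -mulr_sumr.
  exact: ler_wpM2l.
have pow_gt0 : 0 < 2 ^+ k :> R by rewrite exprn_gt0.
rewrite -(ler_pM2l pow_gt0).
apply: (@le_trans _ _ (2 * \sum_(xi : {ffun 'I_k -> bool}) \sum_i w i * \sum_iota weight iota *
    prob (L (sample xi iota)) [set f | f (x i) != xi i])).
  rewrite exchange_big/= !mulr_sumr; apply: ler_sum => i _.
  rewrite -mulr_sumr mulrCA [X in _ <= X]mulrCA ler_wpM2l//.
  have := unseen_error i LP; lra.
rewrite [X in _ <= X]mulrCA ler_wpM2l//.
apply: le_trans (ler_sum _ (fun xi _ => le_sum xi)) _.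
by rewrite sumr_const card_ffun card_bool card_ord -[X in X <= _]mulr_natl natrX.
Qed.

Lemma weighted_failure (a b : R) (w : 'I_k -> R) :
  0 <= a -> 0 <= b -> (forall i, 0 <= w i) ->
  (forall xi (f : model X),
     \sum_i w i * (f (x i) != xi i)%:R <= a + b * (eps < loss xi f)%R%:R) ->
  \sum_i w i * (1 - p i) ^+ n <= 2 * (a + b * delta).
Proof.
move=> a0 b0 w0 wab; have [L LP Ldelta] := failure_sum.
exact: avg_failure LP b0 w0 wab a0 Ldelta.
Qed.

End LowerBound.

(** * Lower rates *)

Section LowerRates.
Variables (X : Type) (S B : set (phyp X)) (n k : nat) (eps delta : R).
Hypothesis learnable : CompL n S B eps delta.
Variable x : 'I_k.+2 -> X.
Hypothesis x_inj : injective x.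
Hypothesis S_shatters : forall xi : 'I_k.+2 -> bool,
  exists2 s, S s & forall i, s (x i) = Some (xi i).
Hypothesis B_shatters : forall xi : 'I_k.+2 -> bool,
  exists2 b, B b & forall i, b (x i) = Some (xi i).
Hypothesis eps_bound : 0 < eps < 1/4.
Hypothesis delta_bound : 0 < delta < 1/4.

Lemma confidence_lower : (1 - 2 * eps) ^+ n <= 2 * delta.
Proof.
have [eps0 eps1] := andP eps_bound; have [delta0 delta1] := andP delta_bound.
pose i1 : 'I_k.+2 := lift ord0 ord0.
pose p (i : 'I_k.+2) : R := if i == ord0 then 1 - 2 * eps else (i == i1)%:R * (2 * eps).
have eps12 : 0 <= 1 - 2 * eps by lra.
have eps2 : 0 <= 2 * eps by lra.
have p0 i : 0 <= p i by rewrite /p; case: eqP => _ //; rewrite mulr_ge0.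
have p_sum : \sum_i p i = 1.
  rewrite (bigD1 ord0)//= (bigD1 i1)//= big1 => [|i /andP[/negPf i0 /negPf ii]].
    by rewrite /p /= ?eqxx ?mul1r ?mulr1 ?addr0; lra.
  by rewrite /p i0 ii mul0r.
(* With all test weight on the light point, a mistake there alone costs 2 eps > eps: hence a = 0 and
   b = 1. *)
have := @weighted_failure X S B n eps delta learnable _ x p x_inj S_shatters B_shatters p0 p_sum
  0 1 (fun i => (i == i1)%:R) (lexx 0) ler01 (fun i => ler0n _ _).
rewrite (bigD1 i1)//= big1 => [|i /negPf ->]; last by rewrite mul0r.
rewrite /p /= mulr1n mul1r addr0 [X in 1 - X]mulr1n mul1r add0r mul1r; apply=> xi f.
rewrite (bigD1 i1)//= big1 => [|i /negPf ->]; last by rewrite mul0r.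
rewrite mulr1n !mul1r addr0 add0r ler_nat.
have [//|ne] := eqVneq (f (x i1)) (xi i1); rewrite lt0b /loss (bigD1 i1)//=.
apply: ltr_wpDr.
  by apply: sumr_ge0 => i _; apply: mulr_ge0 => //; exact: p0.
by rewrite ne /p /= !mulr1n mul1r mulr1; lra.
Qed.

Lemma dimension_lower : (1 - 4 * eps / k.+1%:R) ^+ n <= 7/8.
Proof.
have [eps0 eps1] := andP eps_bound; have [delta0 delta1] := andP delta_bound.
set q := 4 * eps / k.+1%:R.
have k0 : 0 < k.+1%:R :> R by rewrite ltr0n.
have q0 : 0 <= q by rewrite divr_ge0 ?ltW//; lra.
have kq : k.+1%:R * q = 4 * eps by rewrite mulrC divfK// gt_eqF.
pose w (i : 'I_k.+2) : R := if i == ord0 then 0 else q.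
pose p (i : 'I_k.+2) : R := if i == ord0 then 1 - 4 * eps else q.
have eps14 : 0 <= 1 - 4 * eps by lra.
have p0 i : 0 <= p i by rewrite /p; case: eqP.
have w0 i : 0 <= w i by rewrite /w; case: eqP.
have p_sum : \sum_i p i = 1.
  rewrite big_ord_recl /p eqxx; under eq_bigr do rewrite /=.
  by rewrite sumr_const card_ord -[q *+ _]mulr_natl kq; lra.
have eps3 : 0 <= 3 * eps by lra.
(* The light points weigh 4 eps altogether, and an acceptable model loses at most eps on them: hence
   a = eps and b = 3 eps. The bound 7/8 comes from (1 + 3 delta) / 2. *)
have := @weighted_failure X S B n eps delta learnable _ x p x_inj S_shatters B_shatters p0 p_sum
  eps (3 * eps) w (ltW eps0) eps3 w0.
have -> : \sum_i w i * (1 - p i) ^+ n = 4 * eps * (1 - q) ^+ n.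
  rewrite big_ord_recl /w /p eqxx mul0r add0r; under eq_bigr do rewrite /=.
  by rewrite sumr_const card_ord -[(_ * _) *+ _]mulr_natl mulrA kq.
move=> h; have {}h : 4 * eps * (1 - q) ^+ n <= 2 * (eps + 3 * eps * delta).
  apply: h => xi f; case: ltP => [_|le].
    apply: (@le_trans _ _ (\sum_i w i)).
      by apply: ler_sum => i _; rewrite ler_piMr// lern1 leq_b1.
    rewrite big_ord_recl /w eqxx add0r; under eq_bigr do rewrite /=.
    rewrite sumr_const card_ord -[q *+ _]mulr_natl kq.
    by rewrite [X in _ <= _ + _ * X]mulr1n; lra.
  rewrite mulr0 addr0; apply: le_trans le; apply: ler_sum => i _; apply: ler_wpM2r => //.
  by rewrite /w /p; case: eqP => // _; lra.
have e4 : 0 < 4 * eps by lra.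
rewrite -(ler_pM2l e4); apply: le_trans h _; nra.
Qed.

(** Bernoulli's inequality turns [dimension_lower] into k + 1 <= 32 n eps, hence k + 2 <= 64 n eps;
    [confidence_lower] gives 16 n eps for the logarithm, and 64 + 16 = 80. *)
Lemma sample_size_lower : k.+2%:R + ln (delta^-1) / ln 2 <= 80 * (n%:R * eps).
Proof.
have [eps0 eps1] := andP eps_bound; have [delta0 delta1] := andP delta_bound.
have k0 : 0 < k.+1%:R :> R by rewrite ltr0n.
have k1 : 1 <= k.+1%:R :> R by rewrite ler1n.
have dim : k.+2%:R <= 64 * (n%:R * eps).
  have q1 : 4 * eps / k.+1%:R <= 1.
    by rewrite ler_pdivrMr// mul1r; lra.
  have bern m (y : R) : 0 <= y <= 1 -> 1 - m%:R * y <= (1 - y) ^+ m.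
    move=> /andP[y0 y1]; elim: m => [|m IH]; first by rewrite mul0r subr0 expr0.
    have y1' : 0 <= 1 - y by lra.
    rewrite exprS; apply: le_trans (ler_wpM2l y1' IH).
    rewrite -natr1; have : 0 <= m%:R * y * y :> R by rewrite !mulr_ge0.
    nra.
  have q0 : 0 <= 4 * eps / k.+1%:R by rewrite divr_ge0 ?ltW//; lra.
  have := le_trans (bern n _ (introT andP (conj q0 q1))) dimension_lower.
  move=> h; have : 1/8 <= n%:R * (4 * eps) / k.+1%:R.
    by rewrite -mulrA; move: h; generalize (n%:R * (4 * eps / k.+1%:R)) => y; lra.
  by rewrite ler_pdivlMr// => h'; rewrite -[k.+2%:R]natr1; lra.
have conf : ln (delta^-1) <= 8 * (n%:R * eps).
  have h1 : expR (- (4 * eps)) <= 1 - 2 * eps.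
    rewrite expRN -div1r ler_pdivrMr ?expR_gt0//.
    have -> : 4 * eps = 2 * eps + 2 * eps by lra.
    have h2 := expR_ge1Dx (2 * eps); rewrite exp.expRD.
    have h3 : (1 + 2 * eps) * (1 + 2 * eps) <= expR (2 * eps) * expR (2 * eps).
      by apply: ler_pM => //; lra.
    have h4 : 0 <= 1 - 2 * eps by lra.
    apply: le_trans (ler_wpM2l h4 h3); nra.
  have h2 : expR (- (4 * eps)) ^+ n <= 2 * delta.
    apply: le_trans confidence_lower; apply: lerXn2r => //.
    - by rewrite nnegrE expR_ge0.
    - by rewrite nnegrE; lra.
  have h3 : expR (- (8 * (n%:R * eps))) <= delta.
    (* Squaring absorbs the factor 2: (2 delta)^2 <= delta for delta < 1/4. *)
    have -> : - (8 * (n%:R * eps)) = n%:R * - (4 * eps) + n%:R * - (4 * eps) by lra.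
    have h0 := expR_ge0 (n%:R * - (4 * eps)).
    rewrite -expRM_natl in h2; rewrite exp.expRD.
    apply: (@le_trans _ _ ((2 * delta) * (2 * delta))); first exact: ler_pM.
    nra.
  rewrite lnV ?posrE//.
  have : - (8 * (n%:R * eps)) <= ln delta by rewrite -ler_expR lnK ?posrE.
  lra.
have ln2 : 1/2 <= ln 2 :> R.
  rewrite -ler_expR lnK ?posrE//; apply: le_trans (expR_le_quad _) _ => //.
  by rewrite expr2; lra.
have ln2_gt0 : 0 < ln 2 :> R by lra.
have : ln (delta^-1) / ln 2 <= 16 * (n%:R * eps).
  rewrite ler_pdivrMr//; have : 0 <= n%:R * eps by rewrite mulr_ge0// ltW.
  move=> ne; nra.
lra.
Qed.

End LowerRates.

(** * Arithmetic of the rates *)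

(** Any n admitting a learner bounds the size of every list shattered by both classes, so [mutualVC]
    is finite as soon as a learner exists; otherwise the infimum is +oo. *)
Lemma numCompL_lower (X : Type) (S B : set (phyp X)) (eps delta : R) :
  0 < eps < 1/4 -> 0 < delta < 1/4 -> (2%:R%:E <= mutualVC S B)%E ->
  ((80^-1)%:E * (mutualVC S B * (eps^-1)%:E + (eps^-1 * (ln (delta^-1) / ln 2))%:E)
    <= numCompL S B eps delta)%E.
Proof.
move=> heps hdelta VC2; have [eps0 _] := andP heps.
set L := ln (delta^-1) / ln 2.
apply: le_ereal_inf_tmp => _ [n nCL <-].
have size_le (l : seq {classic X}) : uniq l -> shattered S [set x | x \in l] ->
    shattered B [set x | x \in l] -> (1 < size l)%N -> (size l)%:R <= 80 * (n%:R * eps) - L.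
  move=> ul Sl Bl l2; pose k := (size l - 2)%N.
  have lk : size l = k.+2 by rewrite /k; lia.
  pose x (i : 'I_k.+2) : X := tnth (Tuple (introT eqP lk)) i.
  have x_inj : injective x.
    by have /tuple_uniqP : uniq (Tuple (introT eqP lk)) := ul.
  have ext (H : set (phyp X)) : shattered H [set y | y \in l] -> forall xi : 'I_k.+2 -> bool,
      exists2 h, H h & forall i, h (x i) = Some (xi i).
    move=> Hl xi; have [h Hh hl] := Hl (fun y : {classic X} => [exists i, (x i == y :> {classic X}) && xi i]).
    exists h => // i; rewrite hl; last exact: mem_tnth.
    congr Some; apply/existsP/idP => [[j /andP[/eqP/x_inj <-//]]|xii].
    by exists i; rewrite eqxx.
  have := sample_size_lower nCL x_inj (ext S Sl) (ext B Bl) heps hdelta.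
  by rewrite lk -/L; lra.
have VC_le : (mutualVC S B <= (80 * (n%:R * eps) - L)%:E)%E.
  (* The size bound is for lists of at least two points; shorter lists are compared with such a
     list, which exists because [mutualVC] is at least 2. *)
  have [[l0 [ul0 [Sl0 [Bl0 l0_2]]]]|small] := pselect (exists l : seq {classic X},
      [/\ uniq l & shattered S [set x | x \in l] /\ shattered B [set x | x \in l] /\ (1 < size l)%N]).
    apply: ge_ereal_sup => _ [l [ul [Sl Bl]] <-]; rewrite lee_fin.
    have [l2|l1] := ltnP 1 (size l); first exact: size_le.
    apply: le_trans (size_le l0 ul0 Sl0 Bl0 l0_2); rewrite ler_nat.
    exact: leq_trans l1 (ltnW l0_2).
  have : (mutualVC S B <= 1%:E)%E.
    apply: ge_ereal_sup => _ [l [ul [Sl Bl]] <-]; rewrite lee_fin lern1.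
    by rewrite leqNgt; apply/negP => l2; apply: small; exists l.
  by move=> /(le_trans VC2); rewrite lee_fin lern1.
have VC_fin : mutualVC S B \is a fin_num.
  by rewrite fin_numE; apply/andP; split; apply/eqP => VCe; [move: VC2|move: VC_le]; rewrite VCe.
move: VC_le; rewrite -(fineK VC_fin); set v := fine _.
rewrite lee_fin => vle.
rewrite (_ : (_ * _)%E = (80^-1 * (v * eps^-1 + eps^-1 * L))%:E)// lee_fin.
have -> : 80^-1 * (v * eps^-1 + eps^-1 * L) = (v + L) / (80 * eps).
  by field; rewrite gt_eqF.
rewrite ler_pdivrMr; last by lra.
lra.
Qed.

Lemma pow4_le (l : nat) : (l ^ 4 <= 32 * 2 ^ l)%N.
Proof.
have [l6|l6] := leqP 6 l; last by do 6?[case: l l6 => // l l6].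
(* From 6 on, (l + 1)^4 <= 2 l^4. *)
rewrite -(subnK l6); elim: (l - 6)%N => [//|j IH].
rewrite addSn [X in (_ <= _ * X)%N]expnS mulnCA; apply: leq_trans (leq_mul (leqnn 2) IH).
by rewrite !expnS !expn0 !muln1; nia.
Qed.

(** A crude exponent of order Y / eps^2 suffices: only existence is used, and [CompL_sample_size]
    takes the least exponent. *)
Lemma exists_sample_exponent (Y eps : R) : 0 < eps -> 0 <= Y ->
  exists l : nat, Y * l.+1%:R ^+ 2 <= eps ^+ 2 * 2 ^+ l.+1.
Proof.
move=> eps0 Y0; have e2 : 0 < eps ^+ 2 by rewrite exprn_gt0.
exists (Num.bound (32 * Y / eps ^+ 2)); set l := _.+1.
have lY : 32 * Y <= eps ^+ 2 * l%:R ^+ 2.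
  have l1 : 1 <= l%:R :> R by rewrite ler1n.
  have : 32 * Y / eps ^+ 2 <= l%:R.
    apply: ltW; apply: (@lt_le_trans _ _ (Num.bound (32 * Y / eps ^+ 2))%:R).
      by apply: archi_boundP; rewrite divr_ge0// ?mulr_ge0// ltW.
    by rewrite ler_nat.
  rewrite ler_pdivrMr// => h; apply: le_trans h _; rewrite mulrC; apply: ler_wpM2l; first exact: ltW.
  by rewrite expr2 ler_peMr.
have h4 : l%:R ^+ 4 <= 32 * 2 ^+ l :> R.
  by rewrite -!natrX -natrM ler_nat pow4_le.
have l2 : 0 <= l%:R ^+ 2 :> R by rewrite exprn_ge0.
have h5 := ler_wpM2r l2 lY; have := ler_wpM2l (ltW e2) h4.
rewrite (exprD _ 2 2); move: h5; clear.
generalize (2 ^+ l : R) (l%:R ^+ 2 : R) (eps ^+ 2) => P y e h5 h6; lra.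
Qed.

(* With l^4 = O(2^l), a bound eps^2 2^l = O(d l^2) forces l = O(log (d / eps)). *)
Lemma exponent_le (d l : nat) (eps c K : R) : (0 < d)%N -> 0 < eps < 1/4 ->
  0 <= c -> 0 < K -> c ^+ 2 * 32 <= K -> ln K <= 35 * ln 2 ->
  eps ^+ 2 * 2 ^+ l <= c * d%:R * l%:R ^+ 2 ->
  l%:R <= 32 * (ln (d%:R / eps) / ln 2).
Proof.
move=> d0 /andP[e0 e1] c0 K0 cK lnK35 le.
have ln2 : 0 < ln 2 :> R by rewrite ln_gt0// ltr1n.
have d1 : 1 <= d%:R :> R by rewrite ler1n.
have P0 : 0 < 2 ^+ l :> R by rewrite exprn_gt0.
have u4 : 4 <= d%:R / eps by rewrite ler_pdivlMr//; lra.
have u0 : 0 < d%:R / eps by rewrite divr_gt0//; lra.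
have l4 : l%:R ^+ 4 <= 32 * 2 ^+ l :> R.
  by rewrite -!natrX -natrM ler_nat pow4_le.
have PK : 2 ^+ l <= K * (d%:R / eps) ^+ 4.
  (* Square the hypothesis, use l^4 <= 32 * 2^l, and cancel one factor 2^l. *)
  have h : eps ^+ 4 * 2 ^+ l <= K * d%:R ^+ 2.
    rewrite -(ler_pM2r P0).
    apply: (@le_trans _ _ ((c * d%:R * l%:R ^+ 2) ^+ 2)).
      rewrite (_ : eps ^+ 4 * 2 ^+ l * 2 ^+ l = (eps ^+ 2 * 2 ^+ l) ^+ 2); last by ring.
      apply: lerXn2r => //; rewrite nnegrE; last by apply: le_trans le; rewrite mulr_ge0 ?exprn_ge0// ltW.
      by rewrite mulr_ge0 ?exprn_ge0// ltW.
    rewrite (_ : (c * d%:R * l%:R ^+ 2) ^+ 2 = (c * d%:R) ^+ 2 * l%:R ^+ 4); last by ring.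
    apply: le_trans (ler_wpM2l (sqr_ge0 _) l4) _.
    rewrite (_ : (c * d%:R) ^+ 2 * (32 * 2 ^+ l) = (c ^+ 2 * 32) * (d%:R ^+ 2 * 2 ^+ l)); last by ring.
    by rewrite -[X in _ <= X]mulrA; apply: ler_wpM2r => //; rewrite mulr_ge0 ?exprn_ge0// ltW.
  rewrite expr_div_n mulrA ler_pdivlMr ?exprn_gt0// mulrC; apply: le_trans h _.
  by apply: ler_wpM2l; [exact: ltW|exact: ler_weXn2l].
move: u0 u4 PK; generalize (d%:R / eps) => u u0 u4 PK.
have h1 : l%:R * ln 2 <= ln K + 4 * ln u.
  rewrite !mulr_natl -!lnXn// -lnM ?posrE ?exprn_gt0//.
  by rewrite ler_ln ?posrE ?mulr_gt0 ?exprn_gt0.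
have h2 : 2 * ln 2 <= ln u.
  rewrite mulr_natl -lnXn// ler_ln ?posrE ?exprn_gt0//; apply: le_trans u4.
  by rewrite -natrX.
(* Since u >= 4, ln K <= 35 ln 2 is at most 17.5 ln u, and 17.5 + 4 <= 32. *)
rewrite mulrA ler_pdivlMr//; move: h1 h2 lnK35 ln2.
generalize (ln K) (ln 2 : R) (ln u) (l%:R : R) => k a b y; lra.
Qed.

Lemma ln2_le1 : ln 2 <= 1 :> R.
Proof. by rewrite -ler_expR lnK ?posrE//; apply: le_trans (expR_ge1Dx 1). Qed.

Lemma CompL_sample_size (X : Type) (S B : set (phyp X)) (d : nat) (eps delta : R) :
  (0 < d)%N -> 0 < eps < 1/4 -> 0 < delta < 1/4 -> mutualVC S B = d%:R%:E ->
  exists2 n : nat, CompL n S B eps delta &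
    n%:R <= 4 * (80 * 80) * (32 * 32) *
      (d%:R / eps ^+ 2 * (ln (d%:R / eps) / ln 2) ^+ 2
       + 1 / eps ^+ 2 * (ln (delta^-1) / ln 2)).
Proof.
move=> d0 heps /andP[delta0 delta1] VCd; have [eps0 eps1] := andP heps.
set Lam := ln (delta^-1).
have d1 : 1 <= d%:R :> R by rewrite ler1n.
have e2 : 0 < eps ^+ 2 by rewrite exprn_gt0.
have ln2 : 0 < ln 2 :> R by rewrite ln_gt0// ltr1n.
have Lam1 : 1/2 <= Lam.
  rewrite /Lam -ler_expR lnK ?posrE ?invr_gt0//.
  apply: le_trans (expR_le_quad (lexx _)) _; apply: (@le_trans _ _ 4).
    by rewrite expr2; lra.
  by rewrite -[4]invrK lef_pV2 ?posrE ?invr_gt0// -div1r ltW.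
(* This condition implies both numerical hypotheses of [CompL_upper]: (eps / 4)^2 / 2 = eps^2 / 32,
   and 32 * 199 <= 80 * 80. *)
pose P l := 80 * 80 * d%:R * l%:R ^+ 2 + 32 * Lam <= eps ^+ 2 * 2 ^+ l.
have exP : exists l, P l.
  have [|l0 lP] := @exists_sample_exponent (80 * 80 * d%:R + 32 * Lam) eps eps0; first by lra.
  exists l0.+1; rewrite /P; apply: le_trans lP; rewrite [X in _ <= X]mulrDl lerD2l.
  by rewrite ler_peMr ?exprn_ege1 ?ler1n//; lra.
case: (ex_minnP exP) => l Pl lmin.
have l0 : (0 < l)%N.
  rewrite lt0n; apply/eqP => l0; move: Pl; rewrite /P l0 expr0 mulr1 expr0n/= mulr0 add0r.
  by apply/negP; rewrite -ltNge expr2; nra.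
have l1 : 1 <= l%:R :> R by rewrite ler1n.
have l2 : l%:R <= l%:R ^+ 2 :> R by rewrite expr2 ler_peMr.
(* By minimality [P] fails at l - 1, and 2^l is twice 2^(l - 1). *)
have Pl' : eps ^+ 2 * 2 ^+ l <= 2 * (80 * 80 * d%:R * l%:R ^+ 2 + 32 * Lam).
  have : ~~ P l.-1 by apply/negP => /lmin; rewrite -ltnS prednK// ltnn.
  rewrite /P -ltNge => /ltW h.
  have -> : 2 ^+ l = 2 * 2 ^+ l.-1 :> R by rewrite -exprS prednK.
  have h2 : 80 * 80 * d%:R * l.-1%:R ^+ 2 <= 80 * 80 * d%:R * l%:R ^+ 2 :> R.
    apply: ler_wpM2l; first by lra.
    by rewrite lerXn2r ?nnegrE// ler_nat leq_pred.
  rewrite mulrCA; apply: ler_wpM2l => //; apply: le_trans h _.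
  by rewrite lerD2r.
exists (2 ^ l)%N.
  apply: (CompL_upper VCd d0 l0).
  - by apply/andP; split; lra.
  - rewrite !natrM natrX; have P0 : 0 <= 2 ^+ l :> R by rewrite exprn_ge0.
    have h : eps ^+ 2 * 2 ^+ l <= eps * 2 ^+ l.
      by apply: ler_wpM2r => //; rewrite expr2; nra.
    move: Pl; rewrite /P => Pl; have h3 : d%:R * l%:R <= d%:R * l%:R ^+ 2 :> R by rewrite ler_wpM2l.
    have {}Pl : 80 * 80 * (d%:R * l%:R ^+ 2) + 32 * Lam <= eps ^+ 2 * 2 ^+ l by rewrite mulrA.
    have goal_le : 6 * l%:R * (32 * d%:R) <= eps / 4 * 2 ^+ l.
      have dl0 : 0 <= d%:R * l%:R :> R by rewrite mulr_ge0.
      move: (le_trans Pl h) h3 dl0; move: (d%:R * l%:R ^+ 2) (2 ^+ l : R) => u Q {}Pl h3 dl0; lra.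
    exact: goal_le.
  - pose a := (198 * d * l ^ 2)%N.
    have ha : (2 ^ a + 1)%:R <= expR (a.+1)%:R :> R.
      apply: (@le_trans _ _ (2 ^+ a.+1)).
        rewrite -natrX ler_nat expnS mul2n -addnn leq_add2l expn_gt0//.
      rewrite -[a.+1%:R]mul1r exp.expRM_natr; apply: lerXn2r; rewrite ?nnegrE ?expR_ge0//.
      by apply: le_trans (expR_ge1Dx 1).
    apply: le_trans (ler_wpM2r (expR_ge0 _) ha) _.
    rewrite -exp.expRD -[X in _ <= X]lnK ?posrE// ler_expR.
    have lnd : ln delta = - Lam by rewrite /Lam lnV ?posrE// opprK.
    have a1 : a.+1%:R <= 199 * (d%:R * l%:R ^+ 2) :> R.
      have : (0 < d * l ^ 2)%N by rewrite muln_gt0 d0 expn_gt0 l0.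
      rewrite -natrX -!natrM ler_nat /a -mulnA; move: (d * l ^ 2)%N => q; clear; lia.
    have {}Pl : 80 * 80 * (d%:R * l%:R ^+ 2) + 32 * Lam <= eps ^+ 2 * 2 ^+ l by rewrite mulrA.
    have hx : (eps / 4) ^+ 2 / 2 * (2 ^ l)%:R = eps ^+ 2 * 2 ^+ l / 32 by rewrite natrX; field.
    have dl0 : 0 <= d%:R * l%:R ^+ 2 :> R by rewrite mulr_ge0 ?exprn_ge0.
    rewrite lnd hx; move: Pl a1 dl0.
    move: (eps ^+ 2 * 2 ^+ l) (d%:R * l%:R ^+ 2 : R) (a.+1%:R : R) => v w y Pl a1 dl0; lra.
rewrite natrX; set u := d%:R / eps; set L := ln u / ln 2.
have Lam_le : Lam <= Lam / ln 2 by rewrite ler_pdivlMr// ler_piMr ?ln2_le1//; lra.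
have -> : 4 * (80 * 80) * (32 * 32) * (d%:R / eps ^+ 2 * L ^+ 2 + 1 / eps ^+ 2 * (Lam / ln 2))
    = (4 * (80 * 80) * (32 * 32) * (d%:R * L ^+ 2 + Lam / ln 2)) / eps ^+ 2.
  by field; rewrite !gt_eqF.
rewrite ler_pdivlMr// mulrC.
have dL0 : 0 <= d%:R * L ^+ 2 by rewrite mulr_ge0 ?sqr_ge0.
(* Either the confidence term dominates and bounds the sample size directly, or eps^2 2^l = O(d l^2)
   and [exponent_le] replaces l by a logarithm. *)
have [small|large] := leP (80 * 80 * d%:R * l%:R ^+ 2) (32 * Lam); first by lra.
have le4 : eps ^+ 2 * 2 ^+ l <= 4 * (80 * 80) * d%:R * l%:R ^+ 2 by lra.
have lL : l%:R <= 32 * L.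
  apply: (@exponent_le d l eps (4 * (80 * 80)) (32 ^+ 7) d0 heps _ _ _ _ le4).
  - by lra.
  - by rewrite exprn_gt0.
  - rewrite (_ : 32 ^+ 7 = (32 ^+ 3) ^+ 2 * 32 :> R); last by rewrite -exprM -exprSr.
    have c32 : 4 * (80 * 80) <= 32 ^+ 3 :> R by lra.
    by apply: ler_wpM2r => //; apply: lerXn2r => //; rewrite nnegrE; lra.
  - rewrite (_ : 32 = 2 ^+ 5 :> R); last by rewrite -natrX.
    by rewrite -exprM lnXn// mulr_natl.
have lL2 : l%:R ^+ 2 <= 32 * 32 * L ^+ 2.
  rewrite (_ : 32 * 32 * L ^+ 2 = (32 * L) ^+ 2); last by ring.
  by apply: lerXn2r; rewrite ?nnegrE//; apply: le_trans lL.
have c0 : 0 <= 4 * (80 * 80) * d%:R :> R by rewrite !mulr_ge0.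
apply: le_trans le4 _; apply: le_trans (ler_wpM2l c0 lL2) _.
have Lam0 : 0 <= Lam / ln 2 by rewrite divr_ge0 ?(ltW ln2)//; lra.
move: Lam0; generalize (Lam / ln 2) (L ^+ 2) => b c b0; lra.
Qed.

(** Numerals read in the scope of the Stdlib reals are built from [IZR]; they are identified with
    ring numerals. *)
Lemma IZR2E : Rdefinitions.IZR (BinNums.Zpos (BinNums.xO BinNums.xH)) = 2.
Proof. by rewrite !RealsE. Qed.

Lemma IZR4E :
  Rdefinitions.IZR (BinNums.Zpos (BinNums.xO (BinNums.xO BinNums.xH))) = 4.
Proof. by rewrite !RealsE. Qed.

Lemma log2E (u : R) : log2 u = ln u / ln 2.
Proof. by rewrite /log2 RdivE. Qed.

Lemma logpE (u : R) : 2 <= u -> logp u = ln u / ln 2.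
Proof. by move=> u2; rewrite /logp IZR2E (max_idPr u2) log2E. Qed.

Definition upper_constant : R := 4 * (80 * 80) * (32 * 32).

Lemma numCompL_upper (X : Type) (S B : set (phyp X)) (d : nat) (eps delta : R) :
  0 < eps < 1/4 -> 0 < delta < 1/4 -> mutualVC S B = d%:R%:E ->
  (numCompL S B eps delta <= (upper_constant *
     (d%:R / eps ^+ 2 * logp (d%:R / eps) ^+ 2 + 1 / eps ^+ 2 * log2 (delta^-1)))%:E)%E.
Proof.
move=> heps hdelta VCd; have [eps0 eps1] := andP heps; have [delta0 delta1] := andP hdelta.
rewrite log2E; have [d0|d0] := posnP d; last first.
  have d1 : 1 <= d%:R :> R by rewrite ler1n.
  (* d / eps >= 4, so the maximum with 2 in [logp] is d / eps. *)
  rewrite logpE; last by rewrite ler_pdivlMr//; lra.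
  have [n nCL nle] := CompL_sample_size d0 heps hdelta VCd.
  apply: (@le_trans _ _ n%:R%:E); last by rewrite lee_fin.
  by apply: ereal_inf_lbound; exists n.
(* A supremum equal to 0 is not over the empty set, so some list is shattered by both classes; hence
   both are non-empty. *)
have [l [_ [Sl Bl]]] : exists l : seq {classic X}, uniq l /\
    shattered S [set x | x \in l] /\ shattered B [set x | x \in l].
  apply: contrapT => no; move: VCd; rewrite /mutualVC.
  rewrite (_ : [set _ | _ in _] = classical_sets.set0) ?ereal_sup0//.
  by apply/seteqP; split=> // t [l lP _]; case: no; exists l.
have S0 : S !=set0.
  by case: (Sl (fun=> true)) => s Ss _; exists s.
have B0 : B !=set0.
  by case: (Bl (fun=> true)) => b Bb _; exists b.
subst d; have CL0 := CompL_VC0 VCd S0 B0 eps0 delta0.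
apply: (@le_trans _ _ (0%:R)%:E); first by apply: ereal_inf_lbound; exists 0%N.
rewrite lee_fin !mul0r add0r mulr_ge0//; first by rewrite /upper_constant; lra.
rewrite mulr_ge0//; first by rewrite divr_ge0 ?exprn_ge0// ltW.
rewrite divr_ge0//; last by rewrite ln_ge0 ?ler1n.
by rewrite ln_ge0// -invr1 lef_pV2 ?posrE//; lra.
Qed.

(* Imported only here, as it makes %R denote R_scope instead of ring_scope. *)
From Stdlib Require Import Rdefinitions.
Local Open Scope ereal_scope.

Theorem theorem3p2 :
  exists C c : R, (0 < C)%R /\ (0 < c)%R /\
  forall (X : Type), inhabited X ->
  forall (S B : set (phyp X)) (eps delta : R),
    (0 < eps < 1/4)%R -> (0 < delta < 1/4)%R ->
    (forall d : nat, mutualVC S B = (d%:R)%:E ->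
       numCompL S B eps delta <=
         (C * (d%:R / eps ^+ 2 * logp (d%:R / eps) ^+ 2
               + 1 / eps ^+ 2 * log2 (1 / delta)))%:E) /\
    ((2%:R)%:E <= mutualVC S B ->
       c%:E * (mutualVC S B * (1 / eps)%:E + (1 / eps * log2 (1 / delta))%:E)
         <= numCompL S B eps delta).
Proof.
have Rdiv4 : Rdiv (IZR 1) (IZR 4) = GRing.mul 1%:R (GRing.inv 4%:R).
  by rewrite RdivE IZR4E R1E.
exists upper_constant, (GRing.inv 80%:R); split; first by apply/RltP; rewrite /upper_constant !mulr_gt0.
split; first by apply/RltP; rewrite invr_gt0.
move=> X _ S B eps delta [/RltP eps0 /RltP eps1] [/RltP delta0 /RltP delta1].
have heps := introT andP (conj eps0 eps1); have hdelta := introT andP (conj delta0 delta1).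
rewrite Rdiv4 in heps hdelta.
have dinv : Rdiv 1 delta = GRing.inv delta by rewrite RdivE R1E div1r.
split=> [d VCd|VC2].
  by rewrite RdivE dinv; exact: numCompL_upper.
have := numCompL_lower heps hdelta VC2; rewrite dinv log2E !div1r.
by apply.
Qed.
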